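(* Consider the Gumbel-max watermark model of the context with $\varepsilon_n\asymp n^{-p}$, suppose Assumption (A) holds, and suppose that almost surely $\mathbf{P}_t\in\mathcal{P}_{\Delta_n}$ for all $1\le t\le n$, where $\Delta_n\asymp n^{-q}$, with constants $p,q\ge0$ satisfying $q+2p<1$. Fix $\delta>0$ and any sequence $c_n^+$ with $0\le c_n^+\le\Delta_n$. Then the Higher Criticism test that rejects $H_0$ if and only if $\mathrm{HC}_n^+\ge\sqrt{2(1+\delta)\log\log n}$ has Type I error plus Type II error tending to $0$ as $n\to\infty$.
   Context: Notation: $a_n \asymp b_n$ means there are constants $C_1,C_2>0$ with $C_1 a_n\le b_n\le C_2 a_n$ for all $n$. $\mathcal{W}$ is a finite vocabulary; $\mathcal{P}_\Delta=\{\mathbf{P}:\max_w P_w\le 1-\Delta\}$. For a probability vector $\mathbf{P}$ on $\mathcal{W}$, $\mu_{1,\mathbf{P}}$ is the distribution on $[0,1]$ with CDF $F_{1,\mathbf{P}}(r)=\sum_w P_w r^{1/P_w}$; $\mu_0=U(0,1)$. Watermark model: for $t=1,\dots,n$ a random next-token distribution $\mathbf{P}_t$ is produced, $\xi_t=(U_{t,w})_w$ has i.i.d. $U(0,1)$ entries, the decoder is $\mathcal{S}(\mathbf{P},\xi)=\arg\max_w\frac{\log U_w}{P_w}$, the observed token is $w_t$ and $Y_t=U_{t,w_t}$. Let $\mathcal{F}_{t-1}=\sigma(\{w_j,\xi_j,\mathbf{P}_{j+1}\}_{j=1}^{t-1})$. Assumption (A): (a) $\xi_1,\dots,\xi_n$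 are i.i.d. and $\xi_t$ is independent of $\mathcal{F}_{t-1}$; (b) with probability $\varepsilon_n$, $w_t=\mathcal{S}(\mathbf{P}_t,\xi_t)$; otherwise $w_t$ is drawn from $\mathbf{P}_t$ and, conditionally on $\mathcal{F}_{t-1}$, is independent of $\xi_t$. $H_1^{\mathrm{mix}}$: law of $Y_{1:n}$ under this model; $H_0$: $Y_1,\dots,Y_n$ i.i.d. $U(0,1)$. HC statistic: $\mathrm{p}_t=1-Y_t$, sorted $\mathrm{p}_{(1)}<\dots<\mathrm{p}_{(n)}$, $\mathrm{p}_{(n+1)}=1$, $\mathrm{HC}_{n,t}=\sqrt n\,\frac{t/n-\mathrm{p}_{(t)}}{\sqrt{\mathrm{p}_{(t)}(1-\mathrm{p}_{(t)})}}$, and $\mathrm{HC}_n^+=\sup_{t\in\{1,\dots,n\}:\mathrm{p}_{(t+1)}\ge c_n^+}\mathrm{HC}_{n,t}$. *)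

(* Defs.v *)
From HB Require Import structures.
From mathcomp Require Import all_boot all_order all_algebra.
From mathcomp Require Import all_classical all_reals all_analysis.
Set Implicit Arguments. Unset Strict Implicit. Unset Printing Implicit Defensive.
Import Order.TTheory GRing.Theory Num.Theory.
Import numFieldNormedType.Exports.
Local Open Scope classical_set_scope.
Local Open Scope ring_scope.

Definition asymp (R : realType) (a b : nat -> R) : Prop :=
  exists C1 C2 : R, 0 < C1 /\ 0 < C2 /\
    forall n : nat, (1 <= n)%N -> C1 * a n <= b n /\ b n <= C2 * a n.

Definition probvec (R : realType) (W : finType) (P : W -> R) : Prop :=
  (forall w, 0 <= P w) /\ \sum_(w : W) P w = 1.

Definition in_PDelta (R : realType) (W : finType) (Delta : R) (P : W -> R) : Prop :=
  forall w, P w <= 1 - Delta.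

Definition gscore (R : realType) (W : finType) (P U : W -> R) (w : W) : \bar R :=
  if 0 < P w then (ln (U w) / P w)%:E else -oo%E.

Definition gumbel_argmax (R : realType) (W : finType) (P U : W -> R) (w : W) : Prop :=
  forall v, (gscore P U v <= gscore P U w)%E.

Definition mutual_indep (R : realType) (d : measure_display) (T : measurableType d)
  (mu : probability T R) (K : eqType) (I : set K) (X : K -> T -> R) : Prop :=
  forall s : seq K, uniq s -> (forall i, i \in s -> I i) ->
  forall A : K -> set R, (forall i, measurable (A i)) ->
  mu (\bigcap_(i in [set` s]) (X i @^-1` A i)) = (\prod_(i <- s) mu (X i @^-1` A i))%E.

Definition uniform01 (R : realType) (d : measure_display) (T : measurableType d)
  (mu : probability T R) (X : T -> R) : Prop :=
  forall x : R, 0 <= x <= 1 -> mu [set w | X w <= x] = x%:E.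

Definition indep_sys (R : realType) (d : measure_display) (T : measurableType d)
  (mu : probability T R) (F G : set (set T)) : Prop :=
  forall A B, F A -> G B -> mu (A `&` B) = (mu A * mu B)%E.

(* generators of F_{t-1} = σ({w_j, ξ_j, P_{j+1}}_{j=1}^{t-1}) *)
Definition hist_gen (R : realType) (W : finType) (d : measure_display) (T : measurableType d)
  (Pt : nat -> T -> W -> R) (U : nat -> T -> W -> R) (wt : nat -> T -> W) (t : nat)
  : set (set T) :=
  [set E | exists j : nat, (1 <= j < t)%N /\
     ((exists v : W, E = wt j @^-1` [set v]) \/
      (exists (v : W) (A : set R), measurable A /\ E = (fun x => U j x v) @^-1` A) \/
      (exists (v : W) (A : set R), measurable A /\ E = (fun x => Pt j.+1 x v) @^-1` A))].

Definition hist (R : realType) (W : finType) (d : measure_display) (T : measurableType d)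
  (Pt : nat -> T -> W -> R) (U : nat -> T -> W -> R) (wt : nat -> T -> W) (t : nat)
  : set (set T) := <<s hist_gen Pt U wt t >>.

Definition xi_gen (R : realType) (W : finType) (d : measure_display) (T : measurableType d)
  (U : nat -> T -> W -> R) (t : nat) : set (set T) :=
  [set E | exists (v : W) (A : set R), measurable A /\ E = (fun x => U t x v) @^-1` A].

Definition sigma_xi (R : realType) (W : finType) (d : measure_display) (T : measurableType d)
  (U : nat -> T -> W -> R) (t : nat) : set (set T) := <<s xi_gen U t >>.

(* The watermark model with horizon n and mixing probability eps, under Assumption (A).
   Pt t x = P_t, U t x = ξ_t = (U_{t,w})_w, wt t x = w_t; the latent event B t is
   "token t is generated by the watermark decoder" (probability eps). *)
Definition assumptionA (R : realType) (W : finType) (d : measure_display) (T : measurableType d)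
  (mu : probability T R) (n : nat) (eps : R)
  (Pt : nat -> T -> W -> R) (U : nat -> T -> W -> R) (wt : nat -> T -> W) : Prop :=
  (forall t w, measurable_fun setT (fun x => U t x w)) /\
  (forall t w, measurable_fun setT (fun x => Pt t x w)) /\
  (forall t v, measurable (wt t @^-1` [set v])) /\
  (forall t x, (1 <= t <= n)%N -> probvec (Pt t x)) /\
  mutual_indep mu [set tw : nat * W | (1 <= tw.1 <= n)%N] (fun tw x => U tw.1 x tw.2) /\
  (forall t w, (1 <= t <= n)%N -> uniform01 mu (fun x => U t x w)) /\
  (forall t, (1 <= t <= n)%N -> indep_sys mu (sigma_xi U t) (hist Pt U wt t)) /\
  exists B : nat -> set T, forall t, (1 <= t <= n)%N ->
    [/\ measurable (B t), mu (B t) = eps%:E,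
        indep_sys mu [set B t] (<<s hist_gen Pt U wt t `|` xi_gen U t >>),
        (forall x, B t x -> gumbel_argmax (Pt t x) (U t x) (wt t x)) &
        (forall (v : W) E A, hist Pt U wt t E -> sigma_xi U t A ->
           mu (~` B t `&` (wt t @^-1` [set v]) `&` E `&` A)
           = ((1 - eps)%:E * mu A * \int[mu]_(x in E) (Pt t x v)%:E)%E)].

Definition as_PDelta (R : realType) (W : finType) (d : measure_display) (T : measurableType d)
  (mu : probability T R) (n : nat) (Delta : R) (Pt : nat -> T -> W -> R) : Prop :=
  exists N : set T, measurable N /\ mu N = 0%E /\
    forall x, ~ N x -> forall t, (1 <= t <= n)%N -> in_PDelta Delta (Pt t x).

Definition null_model (R : realType) (d : measure_display) (T : measurableType d)
  (mu : probability T R) (n : nat) (Y : nat -> T -> R) : Prop :=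
  (forall t, measurable_fun setT (Y t)) /\
  mutual_indep mu [set t : nat | (1 <= t <= n)%N] Y /\
  (forall t, (1 <= t <= n)%N -> uniform01 mu (Y t)).

Definition pvals (R : realType) (n : nat) (Y : nat -> R) : seq R :=
  sort <=%R [seq 1 - Y t | t <- iota 1 n].

Definition porder (R : realType) (n : nat) (Y : nat -> R) (t : nat) : R :=
  if (t <= n)%N then nth 0 (pvals n Y) t.-1 else 1.

Definition HCnt (R : realType) (n : nat) (Y : nat -> R) (t : nat) : R :=
  Num.sqrt n%:R * (t%:R / n%:R - porder n Y t)
  / Num.sqrt (porder n Y t * (1 - porder n Y t)).

Definition HCplus (R : realType) (n : nat) (c : R) (Y : nat -> R) : \bar R :=
  \big[Order.max/-oo%E]_(t <- iota 1 n | c <= porder n Y t.+1) (HCnt n Y t)%:E.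

Definition hc_threshold (R : realType) (delta : R) (n : nat) : R :=
  Num.sqrt (2 * (1 + delta) * ln (ln n%:R)).

(* Main.v *)
(* Type I error. If N(s) counts the p-values at most s, then for b >= 0 the process
   (1 + b)^N(s) (1 - b s / (1 - s))^(n - N(s)) is a martingale in s under the null, and
   Doob's inequality bounds its maximum.  In the variable sg = sqrt (n s / (1 - s)) one
   choice of b handles all of [sg0, (1 + a) sg0] with the sharp exponent
   x^2 / 2 (1 - O(a)), so the range a few multiples of x away from both ends costs
   O(log n) blocks of probability (log n)^-(1 + delta / 2); each of the two ends is a
   single crude block, and sg^2 < 1 / x forces a p-value below 1 / (x n).

   Type II error. Take s = Delta.  Conditionally on the past, a watermarked token has
   p-value at most Delta as soon as the most likely token has; and with an additional
   probability of order Delta a token of probability at least Delta / |W| wins with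
   a p-value below Delta / 2.  So every count has conditional probability at least
   Delta (1 + eps kappa), and a Laplace transform bound gives N(Delta) - n Delta of
   order n eps Delta, which dominates sqrt (n Delta log log n) since q + 2 p < 1.
   As F_0 is trivial, the law of P_1 given xi_1 is unconstrained, and t = 1 is dropped. *)
Require Import Defs.
From HB Require Import structures.
From mathcomp Require Import all_boot all_order all_algebra.
From mathcomp Require Import all_classical all_reals all_analysis.
From mathcomp Require Import ring lra zify.
Import Order.TTheory GRing.Theory Num.Theory.
Import numFieldNormedType.Exports.
Local Open Scope classical_set_scope.
Local Open Scope ring_scope.
Set Implicit Arguments. Unset Strict Implicit. Unset Printing Implicit Defensive.

(** * Doob inequality for the empirical likelihood ratio *)

(** The threshold carries the sharp constant 2 and about log n blocks must be paid for, so a block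
    may lose only a factor 1 - O(a) in the exponent; crude tilts are affordable at the two ends,
    which are not multiplied by log n. Continuous-time martingales are avoided: the sample is
    reduced to the cells of a grid, where the martingale property is an identity between finite
    sums, and a grid of spacing 1 / (4 b n) in the odds s / (1 - s) costs only a factor 2. Under the
    watermark, the event that the uniform of the top token exceeds 1 - Delta has probability Delta,
    just as a p-value below Delta under the null; the gain used here comes from the disjoint event
    on which a minor token wins. Conditional bounds are written pi mu(E) <= mu(Z and E) for E in the
    history, so that no conditional expectation appears. The choice s = Delta respects the cut-off:
    for t = N(Delta) the next p-value exceeds Delta >= c. As the probability spaces change with n,
    both errors are bounded once log log n exceeds a constant that depends on none of them. *)

Lemma doob_finite (R : realFieldType) (T : finType) (w : T -> R) (M : nat -> T -> R)
    (K : nat) (B : R) :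
  (forall f, 0 <= w f) -> (forall k f, (k <= K)%N -> 0 <= M k f) ->
  (forall k, (k < K)%N ->
    let D f := [forall j : 'I_K.+1, (j <= k)%N ==> (M j f < B)] in
    \sum_(f | D f) w f * M k.+1 f = \sum_(f | D f) w f * M k f) ->
  B * \sum_(f | [exists j : 'I_K.+1, B <= M j f]) w f <= \sum_f w f * M 0%N f.
Proof.
move=> w0 M0 HM.
(* [D k] says that the level is not reached up to time k. Each sample is charged at its first
   crossing, where M >= B; the martingale property enters only as an equality of sums over [D k], so
   no filtration is defined. *)
pose D k f := [forall j : 'I_K.+1, (j <= k)%N ==> (M j f < B)].
have claim k : (k <= K)%N ->
  B * \sum_(f | ~~ D k f) w f + \sum_(f | D k f) w f * M k f <= \sum_f w f * M 0%N f.
  elim: k => [_|k IH kK].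
    rewrite [leRHS](bigID (D 0%N)) /= [leLHS]addrC lerD2l mulr_sumr ler_sum // => f.
    rewrite negb_forall => /existsP[j]; rewrite negb_imply leqn0 -leNgt => /andP[/eqP j0].
    by rewrite j0 mulrC => /ler_wpM2l; apply.
  apply: le_trans (IH (ltnW kK)); rewrite -(HM _ kK) -/(D k).
  have DS f : D k.+1 f = D k f && (M k.+1 f < B).
    apply/forallP/andP => [H|[/forallP H1 H2] j].
      split; last by have := H (Ordinal (kK : (k.+1 < K.+1)%N)); rewrite leqnn.
      apply/forallP => j; apply/implyP => jk; exact: (implyP (H j) (leqW jk)).
    apply/implyP; rewrite leq_eqVlt ltnS => /orP[/eqP -> //|jk].
    exact: (implyP (H1 j) jk).
  rewrite [in X in B * X](bigID (D k)) /= mulrDr.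
  have -> : \sum_(i | ~~ D k.+1 i && ~~ D k i) w i = \sum_(i | ~~ D k i) w i.
    apply: eq_bigl => f; rewrite DS; case: (D k f) => //=; exact: andbF.
  rewrite addrAC [leLHS]addrC lerD2l [leRHS](bigID (fun f => M k.+1 f < B)) /= [leLHS]addrC.
  apply: lerD.
    by under eq_bigl => f do rewrite DS.
  rewrite mulr_sumr [leLHS](eq_bigl (fun f => D k f && ~~ (M k.+1 f < B))); last first.
    by move=> f; rewrite DS; case: (D k f) => //=; rewrite andbT.
  by apply: ler_sum => f /andP[_]; rewrite -leNgt mulrC => /ler_wpM2l; apply.
apply: le_trans (claim K (leqnn _)).
rewrite ler_wpDr //; first by apply: sumr_ge0 => f _; rewrite mulr_ge0 // M0.
rewrite le_eqVlt; apply/orP; left; apply/eqP; congr (_ * _); apply: eq_bigl => f.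
rewrite negb_forall.
by apply: eq_existsb => j; rewrite negb_imply -ltnS ltn_ord -leNgt.
Qed.

(** This is conditioning on the coarsening [tau] in product form: [D] is determined by the classes
    [tau (f i)], and for fixed classes the sum of products factors into fiber sums, which agree by
    assumption. *)
Lemma eq_sum_prod_fiber (R : comPzSemiRingType) (I J C : finType) (tau : J -> C)
    (D : pred {ffun I -> J}) (G H : J -> R) :
  (forall f g : {ffun I -> J}, (forall i, tau (f i) = tau (g i)) -> D f = D g) ->
  (forall c, \sum_(j | tau j == c) G j = \sum_(j | tau j == c) H j) ->
  \sum_(f : {ffun I -> J} | D f) \prod_i G (f i) =
  \sum_(f : {ffun I -> J} | D f) \prod_i H (f i).
Proof.
move=> HD GH.
pose t (f : {ffun I -> J}) := [ffun i => tau (f i)] : {ffun I -> C}.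
rewrite (partition_big t predT) //= [RHS](partition_big t predT) //=.
apply: eq_bigr => g _.
case: (pickP [pred f | t f == g]) => [f0 /= /eqP tf0|none]; last first.
  by rewrite !big_pred0 // => f; have /= -> := none f; rewrite andbF.
have E f : D f && (t f == g) = D f0 && (t f == g).
  case: eqP => [tf|]; rewrite ?andbF // !andbT; apply: HD => i.
  by move/ffunP: tf => /(_ i); rewrite -tf0 !ffunE.
under eq_bigl do rewrite E; under [RHS]eq_bigl do rewrite E.
case: (D f0) => /=; last by rewrite !big_pred0.
have fam F : \sum_(f : {ffun I -> J} | t f == g) \prod_i F (f i) =
    \prod_i \sum_(j | tau j == g i) F j.
  rewrite (bigA_distr_big_dep (fun i j => tau j == g i)) /=.
  apply: eq_bigl => f; apply/eqP/familyP => [<- i|H0]; first by rewrite unfold_in ffunE eqxx.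
  by apply/ffunP => i; rewrite ffunE; exact/eqP/(H0 i).
by rewrite !fam; apply: eq_bigr => i _.
Qed.

Definition cell_factor (R : fieldType) (S : nat -> R) (b : R) (k j : nat) : R :=
  if (j < k)%N then 1 + b else 1 - b * (S k / (1 - S k)).

(* With cells (S j, S j+1], the product over the sample of [cell_factor S b k] is the
   likelihood ratio at S k of the law with density 1 + b up to S k, i.e. the martingale
   (1+b)^N (1 - b S k / (1 - S k))^(n-N) with N the number of points in [0, S k]. *)
Lemma doob_cells (R : realFieldType) (n K : nat) (S : nat -> R) (b B : R) :
  S 0%N = 0 -> S K.+1 = 1 -> (forall k, (k <= K)%N -> S k <= S k.+1) ->
  (forall k, (k <= K)%N -> S k < 1) -> 0 <= b ->
  (forall k, (k <= K)%N -> b * (S k / (1 - S k)) <= 1) ->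
  B * \sum_(f : {ffun 'I_n -> 'I_K.+1} |
        [exists k : 'I_K.+1, B <= \prod_i cell_factor S b k (f i)])
        \prod_i (S (f i).+1 - S (f i)) <= 1.
Proof.
move=> S0 SK Sle Slt b0 bS.
have cf0 k j : (k <= K)%N -> 0 <= cell_factor S b k j.
  by move=> kK; rewrite /cell_factor; case: ifP => _; [lra | rewrite subr_ge0 bS].
have tele k : (k <= K)%N -> \sum_(j < K.+1 | (k <= j)%N) (S j.+1 - S j) = 1 - S k.
  move=> kK; rewrite -SK -telescope_sumr; last exact: leqW.
  rewrite -(big_mkord (fun j => (k <= j)%N) (fun j => S j.+1 - S j)).
  rewrite (big_cat_nat (leq0n k) (leqW kK)) /= big_nat_cond big_pred0 ?add0r.
    by rewrite big_nat_cond [RHS]big_nat_cond; apply: eq_bigl => j; case: (k <= j)%N; rewrite ?andbT ?andbF.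
  by move=> j; rewrite ltnNge; case: (k <= j)%N; rewrite ?andbF.
have := @doob_finite R {ffun 'I_n -> 'I_K.+1} (fun f => \prod_i (S (f i).+1 - S (f i)))
  (fun k f => \prod_i cell_factor S b k (f i)) K B.
have -> : \sum_(f : {ffun 'I_n -> 'I_K.+1})
   (\prod_i (S (f i).+1 - S (f i))) * (\prod_i cell_factor S b 0 (f i)) = 1.
  under eq_bigr => f _.
    rewrite -big_split /=; under eq_bigr do rewrite /cell_factor ltn0 S0 mul0r mulr0 subr0 mulr1.
    over.
  rewrite -(bigA_distr_bigA (fun _ (j : 'I_K.+1) => S j.+1 - S j)).
  rewrite big1 // => i _; have := tele 0%N isT; rewrite S0 subr0 => <-.
  by apply: eq_bigl.
apply.
- by move=> f; apply: prodr_ge0 => i _; rewrite subr_ge0 Sle // -ltnS.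
- by move=> k f kK; apply: prodr_ge0 => i _; exact: cf0.
move=> k kK D; rewrite {}/D; under eq_bigr do rewrite -big_split /=.
under [RHS]eq_bigr do rewrite -big_split /=.
(* Merging all cells from k on is the information at grid time k: events up to time k only see
   whether a cell index is below some l <= k. In the merged class both sides total 1 - S k - b S k,
   which is the martingale identity; the other classes are empty or single cells below k, where both
   factors are 1 + b. *)
apply: (@eq_sum_prod_fiber _ _ _ 'I_K.+1 (fun j : 'I_K.+1 => inord (minn j k))
   _ (fun j => (S j.+1 - S j) * cell_factor S b k.+1 j)
     (fun j => (S j.+1 - S j) * cell_factor S b k j)).
  have aux (u v h m : nat) : minn u m = minn v m -> (h <= m)%N -> (u < h)%N = (v < h)%N.
    lia.
  move=> f g fg; apply: eq_forallb => l; case lk: (l <= k)%N => //=.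
  congr (_ < _); apply: eq_bigr => i _; rewrite /cell_factor.
  have /(congr1 (@nat_of_ord _)) /= := fg i; rewrite !inordK; try by rewrite ltnS geq_min (ltnW kK) orbT.
  move=> E; suff -> : (f i < l)%N = (g i < l)%N by [].
  exact: aux E lk.
move=> c; have [ck|ck|ck] := ltngtP c k.
- have E (j : 'I_K.+1) : (inord (minn j k) == c) = (j == c).
    rewrite -!val_eqE /= inordK; last by rewrite ltnS geq_min (ltnW kK) orbT.
    by move: ck; clear; lia.
  under eq_bigl do rewrite E; under [RHS]eq_bigl do rewrite E.
  by rewrite !big_pred1_eq /cell_factor ck leqW.
- have E2 (j : 'I_K.+1) : (inord (minn j k) == c) = false.
    apply/negbTE; rewrite -val_eqE /= inordK; last by rewrite ltnS geq_min (ltnW kK) orbT.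
    by move: ck; clear; lia.
  by rewrite !big_pred0.
have E3 (j : 'I_K.+1) : (inord (minn j k) == c) = (k <= j)%N.
  rewrite -!val_eqE /= inordK; last by rewrite ltnS geq_min (ltnW kK) orbT.
  by move: ck; clear; lia.
under eq_bigl do rewrite E3; under [RHS]eq_bigl do rewrite E3.
have -> : \sum_(j < K.+1 | (k <= j)%N) (S j.+1 - S j) * cell_factor S b k j =
   (1 - S k) * (1 - b * (S k / (1 - S k))).
  rewrite -tele ?(ltnW kK) // mulr_suml; apply: eq_bigr => j kj.
  by rewrite /cell_factor ltnNge kj /= ?tele ?(ltnW kK).
have kK1 : (k < K.+1)%N by exact: ltnW.
rewrite (bigD1 (Ordinal kK1)) //= {1}/cell_factor ltnSn.
have -> : \sum_(j < K.+1 | (k <= j)%N && (j != Ordinal kK1))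
     (S j.+1 - S j) * cell_factor S b k.+1 j = (1 - S k.+1) * (1 - b * (S k.+1 / (1 - S k.+1))).
  rewrite -(tele k.+1) // mulr_suml; apply: eq_big => [j|j /andP[kj jk]].
    by rewrite -val_eqE /= ltn_neqAle eq_sym andbC.
  rewrite /cell_factor ltnNge; move: jk; rewrite -val_eqE /= => jk.
  by rewrite ltn_neqAle eq_sym jk kj /= tele.
have := Slt _ (ltnW kK); have := Slt _ kK => h1 h2.
by field; rewrite !subr_eq0 !gt_eqF.
Qed.

(** * Sharp logarithmic bounds and the exponent of the likelihood ratio *)

Lemma expR_le1D (R : realType) (b : R) : 0 <= b -> expR (b - b ^+ 2 / 2) <= 1 + b.
Proof.
move=> b0; have b1 : 0 < 1 + b by lra.
rewrite -[leRHS](@lnK R) ?posrE // ler_expR.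
(* At y = 1 + b this is ln (1 + b) - (b - b^2 / 2) up to a constant, and the derivative is (y - 1)^2
   / y. *)
pose f (y : R) := ln y + (y ^+ 2 * 2^-1 - y * 2).
have df (y : R) : 0 < y -> is_derive y 1 f (y^-1 + y - 2).
  move=> y0; have ? := is_derive1_ln y0; rewrite /f.
  by apply: is_derive_eq; rewrite /GRing.scale /=; lra.
suff : f 1 <= f (1 + b) by rewrite /f ln1 expr1n; lra.
apply: (@ger0_derive1_ndecr _ f 1 (1 + b)) => // [y|y||]; last lra.
- rewrite in_itv /= => /andP[y0 _]; have Y : 0 < y by lra.
  by have [] := df y Y.
- rewrite in_itv /= => /andP[y0 _]; have Y : 0 < y by lra.
  rewrite derive1E; have [_ ->] := df y Y.
  have -> : y^-1 + y - 2 = (y - 1) ^+ 2 / y by field; rewrite gt_eqF.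
  by rewrite divr_ge0 ?sqr_ge0 // ltW.
- apply: derivable_within_continuous => y; rewrite in_itv /= => /andP[y0 _].
  have Y : 0 < y by lra.
  by have [] := df y Y.
Qed.

(** The quadratic coefficient must tend to 1/2 with z to keep the exponent sharp; on [0, 1/2] the
    cubic term z^3 absorbs the rest of the series. With y = 1 - z, the function [f] is ln (1 - z) +
    z + z^2 / 2 + z^3 up to a constant. *)
Lemma expR_le1B (R : realType) (z : R) : 0 <= z <= 2^-1 ->
  expR (- z - (1 + 2 * z) * z ^+ 2 / 2) <= 1 - z.
Proof.
move=> z01; have b1 : 0 < 1 - z by lra.
rewrite -[leRHS](@lnK R) ?posrE // ler_expR.
pose f (y : R) := ln y - y ^+ 3 + y ^+ 2 * (7/2) - y * 5.
have df (y : R) : 0 < y -> is_derive y 1 f (y^-1 - 3 * y ^+ 2 + 7 * y - 5).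
  move=> y0; have ? := is_derive1_ln y0; rewrite /f.
  by apply: is_derive_eq; rewrite /GRing.scale /=; lra.
suff : f 1 <= f (1 - z) by rewrite /f ln1 expr1n; lra.
apply: (@ler0_derive1_nincr _ f (1 - z) 1) => // [y|y||]; last lra.
- rewrite in_itv /= => /andP[y0 _]; have Y : 0 < y by lra.
  by have [] := df y Y.
- rewrite in_itv /= => /andP[y0 y1]; have Y : 0 < y by lra.
  rewrite derive1E; have [_ ->] := df y Y.
  have -> : y^-1 - 3 * y ^+ 2 + 7 * y - 5 = - ((1 - y) ^+ 2 * (3 * y - 1)) / y.
    by field; rewrite gt_eqF.
  rewrite mulNr oppr_le0 divr_ge0 ?mulr_ge0 ?sqr_ge0 //; lra.
- apply: derivable_within_continuous => y; rewrite in_itv /= => /andP[y0 _].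
  have Y : 0 < y by lra.
  by have [] := df y Y.
Qed.

(* Here o = s / (1 - s) and sg ^+ 2 = n * o, so that b * sg is the tilt b measured in
   standard deviations of the score. *)
Lemma likelihood_ge (R : realType) (n t : nat) (x b s sg : R) :
  0 <= x -> 0 <= b <= 2^-1 -> 0 < s < 1 -> 0 <= sg -> sg ^+ 2 = n%:R * (s / (1 - s)) ->
  b * (s / (1 - s)) <= 2^-1 -> (t <= n)%N ->
  n%:R * s + x * Num.sqrt (n%:R * s * (1 - s)) <= t%:R ->
  expR (x * (b * sg) * (1 - b / 2) - (1 + 2 * (b * (s / (1 - s)))) * (b * sg) ^+ 2 / 2)
    <= (1 + b) ^+ t * (1 - b * (s / (1 - s))) ^+ (n - t).
Proof.
move=> x0 b01 s01 sg0 sgE zle tn tge.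
set o := s / (1 - s) in sgE zle *; set z := b * o in zle *.
have s1 : 0 < 1 - s by lra.
have o0 : 0 < o by rewrite divr_gt0 //; lra.
have z0 : 0 <= z by rewrite mulr_ge0 ?(ltW o0) //; lra.
have sqE : Num.sqrt (n%:R * s * (1 - s)) = sg * (1 - s).
  have -> : n%:R * s * (1 - s) = (sg * (1 - s)) ^+ 2.
    by rewrite exprMn sgE /o; field; rewrite gt_eqF.
  by rewrite sqrtr_sqr ger0_norm // mulr_ge0 // ltW.
rewrite sqE in tge.
have h1 : expR ((b - b ^+ 2 / 2) *+ t) <= (1 + b) ^+ t.
  rewrite -[_ *+ t]mulr_natr expRM_natr; apply: lerXn2r; rewrite ?nnegrE ?expR_ge0 ?expR_le1D //; lra.
have h2 : expR ((- z - (1 + 2 * z) * z ^+ 2 / 2) *+ (n - t)) <= (1 - z) ^+ (n - t).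
  rewrite -[_ *+ (n - t)]mulr_natr expRM_natr; apply: lerXn2r; rewrite ?nnegrE ?expR_ge0 ?expR_le1B //; lra.
apply: le_trans (ler_pM (expR_ge0 _) (expR_ge0 _) h1 h2).
rewrite -expRD ler_expR -[_ *+ t]mulr_natr -[_ *+ (n - t)]mulr_natr natrB //.
have oE : o * (1 - s) = s by rewrite /o divfK // gt_eqF.
move: oE sgE tge; rewrite -/z; clear sqE h1 h2 tn.
set N := n%:R; set T := t%:R => oE sgE tge.
have N0 : 0 <= N by exact: ler0n.
set c := (1 + 2 * z) * z ^+ 2 / 2.
have c0 : 0 <= c by rewrite /c mulr_ge0 ?mulr_ge0 ?sqr_ge0 ?invr_ge0 //; lra.
pose y := x * (sg * (1 - s)).
have y0 : 0 <= y by rewrite /y !mulr_ge0 // ltW.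
have coef0 : 0 <= b - b ^+ 2 / 2 + z + c by nra.
(* The bound on the logarithm is affine in the count with nonnegative slope, so the count may be
   replaced by its lower bound N s + y. *)
have step : (b - b ^+ 2 / 2) * (N * s + y) - (z + c) * (N - (N * s + y)) <=
    (b - b ^+ 2 / 2) * T + (- z - c) * (N - T).
  rewrite -subr_ge0 [X in 0 <= X](_ : _ = (b - b ^+ 2 / 2 + z + c) * (T - (N * s + y))).
    by rewrite mulr_ge0 // subr_ge0.
  by ring.
apply: le_trans step.
(* At this value the first-order terms cancel by [E4] (the score is centred under the null), [E1] is
   the signal, and [E2], [E5] split the variance (b sg)^2 / 2 into shares 1 - s and s, of which only
   the second carries the factor 1 + 2 z. *)
have E1 : y * (b + z) = x * (b * sg).
  rewrite /y /z -[b + b * o]/(b + b * o).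
  have -> : x * (sg * (1 - s)) * (b + b * o) = x * (b * sg) * (1 - s + o * (1 - s)) by ring.
  by rewrite oE; ring.
have E2 : b ^+ 2 * (N * s) = (b * sg) ^+ 2 * (1 - s).
  rewrite exprMn sgE -{1}oE; ring.
have E3 : N * (1 - s) * z ^+ 2 = (b * sg) ^+ 2 * s.
  rewrite [(b * sg) ^+ 2]exprMn sgE /z exprMn -{2}oE; ring.
have E4 : b * (N * s) = z * (N * (1 - s)) by rewrite /z -{1}oE; ring.
have ub : b ^+ 2 * y <= b * (x * (b * sg)).
  rewrite /y -subr_ge0 [X in 0 <= X](_ : _ = b ^+ 2 * (x * sg) * s); last by ring.
  by rewrite !mulr_ge0 ?sqr_ge0 //; lra.
have cy : 0 <= c * y by rewrite mulr_ge0.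
have u0 : 0 <= z * ((b * sg) ^+ 2 * (1 - s)) by rewrite mulr_ge0 // mulr_ge0 ?sqr_ge0 // ltW.
have E5 : c * (N * (1 - s)) = (1 + 2 * z) * ((b * sg) ^+ 2 * s) / 2 by rewrite -E3 /c; ring.
have -> : (b - b ^+ 2 / 2) * (N * s + y) - (z + c) * (N - (N * s + y)) =
  b * (N * s) - z * (N * (1 - s)) + y * (b + z) - b ^+ 2 * (N * s) / 2 - b ^+ 2 * y / 2
   - c * (N * (1 - s)) + c * y by ring.
rewrite E1 E2 E4 E5; lra.
Qed.

Lemma bernoulli_ineq (R : realFieldType) (y : R) (n : nat) :
  0 <= y <= 1 -> 1 - n%:R * y <= (1 - y) ^+ n.
Proof.
move=> y01; elim: n => [|n IH]; first by rewrite mul0r subr0 expr0.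
rewrite exprS; apply: le_trans (ler_wpM2l _ IH); last lra.
rewrite -natr1; have : 0 <= n%:R :> R by []; nra.
Qed.

(** * Real-valued probabilities and measurable covers *)

Definition prob (R : realType) (d : measure_display) (T : measurableType d)
  (mu : probability T R) (A : set T) : R := fine (mu A).

(* Outer-measure bound: the event E itself need not be measurable. *)
Definition covered (R : realType) (d : measure_display) (T : measurableType d)
  (mu : probability T R) (E : set T) (e : R) : Prop :=
  exists C, [/\ measurable C, E `<=` C & prob mu C <= e].

Section Prob.
Context (R : realType) (d : measure_display) (T : measurableType d) (mu : probability T R).
Implicit Types A B : set T.

Lemma probE A : measurable A -> mu A = (prob mu A)%:E.
Proof. by move=> mA; rewrite /prob fineK // fin_num_measure. Qed.

Lemma prob_ge0 A : 0 <= prob mu A.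
Proof. by rewrite /prob fine_ge0. Qed.

Lemma prob0 : prob mu set0 = 0.
Proof. by rewrite /prob measure0. Qed.

Lemma probT : prob mu setT = 1.
Proof. by rewrite /prob probability_setT. Qed.

Lemma le_prob A B : measurable A -> measurable B -> A `<=` B -> prob mu A <= prob mu B.
Proof.
move=> mA mB AB; rewrite -lee_fin -!probE //.
by apply: le_measure => //; rewrite inE.
Qed.

Lemma probU A B : measurable A -> measurable B -> A `&` B = set0 ->
  prob mu (A `|` B) = prob mu A + prob mu B.
Proof.
move=> mA mB AB; apply: EFin_inj; rewrite EFinD -!probE //; last exact: measurableU.
exact: measureU.
Qed.

Lemma probU_le A B : measurable A -> measurable B ->
  prob mu (A `|` B) <= prob mu A + prob mu B.
Proof.
move=> mA mB; rewrite -lee_fin EFinD -!probE //; last exact: measurableU.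
exact: measureU2.
Qed.

Lemma probID A B : measurable A -> measurable B ->
  prob mu A = prob mu (A `&` B) + prob mu (A `&` ~` B).
Proof.
move=> mA mB; rewrite -probU; [|exact: measurableI|apply: measurableI => //; exact: measurableC|].
  by rewrite -setIUr setUv setIT.
by rewrite setIACA setICr setI0.
Qed.

Lemma probC A : measurable A -> prob mu (~` A) = 1 - prob mu A.
Proof.
by move=> mA; have := probID measurableT mA; rewrite probT !setTI => ->; rewrite addrC addKr.
Qed.

Lemma covered_sub (E E' : set T) (e e' : R) :
  E `<=` E' -> e' <= e -> covered mu E' e' -> covered mu E e.
Proof.
move=> EE' ee' [C [mC E'C pC]]; exists C; split => //; last exact: le_trans ee'.
exact: subset_trans E'C.
Qed.

Lemma coveredU (E E' : set T) (e e' : R) :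
  covered mu E e -> covered mu E' e' -> covered mu (E `|` E') (e + e').
Proof.
move=> [C [mC EC pC]] [C' [mC' EC' pC']]; exists (C `|` C'); split.
- exact: measurableU.
- exact: setUSS.
- by apply: le_trans (probU_le mC mC') (lerD pC pC').
Qed.

Lemma covered_seq (I : eqType) (r : seq I) (E : I -> set T) (e : I -> R) :
  (forall i, i \in r -> covered mu (E i) (e i)) ->
  covered mu [set x | exists2 i, i \in r & E i x] (\sum_(i <- r) e i).
Proof.
elim: r => [|a r IH] H.
  by rewrite big_nil; exists set0; split => //; [move=> x []|rewrite prob0].
rewrite big_cons; apply: covered_sub (coveredU (H a _) (IH _)) => //.
- move=> x [i]; rewrite inE => /orP[/eqP -> Ea|ir Ei]; first by left.
  by right; exists i.
- by rewrite mem_head.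
- by move=> i ir; apply: H; rewrite inE ir orbT.
Qed.

Lemma covered_le (E : set T) (e : R) : measurable E -> covered mu E e -> prob mu E <= e.
Proof. by move=> mE [C [mC EC pC]]; apply: le_trans pC; exact: le_prob. Qed.

Lemma measurable_preimage (X : T -> R) (A : set R) :
  measurable_fun setT X -> measurable A -> measurable (X @^-1` A).
Proof. by move=> mX mA; rewrite -[X in measurable X]setTI; exact: mX. Qed.

Lemma measurable_ray_le (a : R) : measurable [set y : R | y <= a].
Proof. by rewrite -set_itvNyc; exact: measurable_itv. Qed.

Lemma measurable_ray_lt (a : R) : measurable [set y : R | y < a].
Proof. by rewrite -set_itvNyo; exact: measurable_itv. Qed.

Lemma uniform01_le (X : T -> R) (x : R) : uniform01 mu X -> 0 <= x <= 1 ->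
  prob mu (X @^-1` [set y | y <= x]) = x.
Proof. by move=> uX x01; rewrite /prob (uX x). Qed.

(** [uniform01] fixes the distribution function on closed rays only. An atom at x would give P(X <
    x) = v < x, which contradicts the value of the distribution function at the midpoint of v and
    x. *)
Lemma uniform01_lt (X : T -> R) (x : R) : measurable_fun setT X -> uniform01 mu X ->
  0 <= x <= 1 -> prob mu (X @^-1` [set y | y < x]) = x.
Proof.
move=> mX uX x01.
have mle a := measurable_preimage mX (measurable_ray_le a).
have mlt a := measurable_preimage mX (measurable_ray_lt a).
apply/eqP; rewrite eq_le; apply/andP; split.
  by rewrite -[leRHS](uniform01_le uX x01); apply: le_prob => // w /ltW.
rewrite leNgt; apply/negP => vx; set v := prob _ _ in vx.
have v0 : 0 <= v by exact: prob_ge0.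
have y01 : 0 <= (v + x) / 2 <= 1 by lra.
have : prob mu (X @^-1` [set y | y <= (v + x) / 2]) <= v.
  apply: le_prob => // w /= Xw; lra.
rewrite uniform01_le //; lra.
Qed.

Lemma uniform01_oo (X : T -> R) (a b : R) : measurable_fun setT X -> uniform01 mu X ->
  0 <= a -> a <= b -> b <= 1 -> prob mu (X @^-1` [set y | a < y < b]) = b - a.
Proof.
move=> mX uX a0; rewrite le_eqVlt => /orP[/eqP <- a1|ab b1].
  rewrite subrr -prob0; congr prob; apply/seteqP; split => // w /=.
  by move=> /andP[] /lt_trans/[apply]; rewrite ltxx.
have mle := measurable_preimage mX (measurable_ray_le a).
have mlt := measurable_preimage mX (measurable_ray_lt b).
have := probID mlt mle; rewrite uniform01_lt //; last lra.
have -> : X @^-1` [set y | y < b] `&` X @^-1` [set y | y <= a] = X @^-1` [set y | y <= a].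
  by apply/seteqP; split => w /= => [[]//|Xa]; split => //; apply: le_lt_trans ab.
rewrite uniform01_le //; last lra.
have -> : X @^-1` [set y | y < b] `&` ~` (X @^-1` [set y | y <= a]) =
   X @^-1` [set y | a < y < b].
  apply/seteqP; split => w /=.
    by move=> [-> /negP]; rewrite -ltNge => ->.
  by move=> /andP[aX ->]; split => //; apply/negP; rewrite -ltNge.
by move=> ?; lra.
Qed.

Lemma uniform01_oc (X : T -> R) (a b : R) : measurable_fun setT X -> uniform01 mu X ->
  0 <= a -> a <= b -> b <= 1 -> prob mu (X @^-1` [set y | a < y <= b]) = b - a.
Proof.
move=> mX uX a0 ab b1.
have mle c := measurable_preimage mX (measurable_ray_le c).
have := probID (mle b) (mle a).
have -> : X @^-1` [set y | y <= b] `&` X @^-1` [set y | y <= a] = X @^-1` [set y | y <= a].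
  by apply/seteqP; split => w /= => [[]//|Xa]; split => //; apply: le_trans ab.
have -> : X @^-1` [set y | y <= b] `&` ~` (X @^-1` [set y | y <= a]) =
   X @^-1` [set y | a < y <= b].
  apply/seteqP; split => w /=.
    by move=> [-> /negP]; rewrite -ltNge => ->.
  by move=> /andP[aX ->]; split => //; apply/negP; rewrite -ltNge.
rewrite !uniform01_le //; [|lra|lra].
by move=> ?; lra.
Qed.

End Prob.

(** * From multinomial cells to the null sample *)

Definition npv (R : realType) (n : nat) (Y : nat -> R) (s : R) : nat :=
  count (fun t => 1 - Y t <= s) (iota 1 n).

Lemma prod_if_count (R : comPzSemiRingType) (I : Type) (r : seq I) (P : pred I) (a b : R) :
  \prod_(i <- r) (if P i then a else b) = a ^+ count P r * b ^+ (size r - count P r).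
Proof.
elim: r => [|i r IH]; first by rewrite big_nil mulr1.
rewrite big_cons IH /=; case: (P i) => /=; first by rewrite add1n subSS exprS mulrA.
by rewrite add0n subSn ?count_size // exprS mulrCA.
Qed.

Lemma prod_iota1 (R : Type) (idx : R) (op : Monoid.law idx) (n : nat) (F : nat -> R) :
  \big[op/idx]_(t <- iota 1 n) F t = \big[op/idx]_(i < n) F i.+1.
Proof. by rewrite -[n in iota 1 n](subn1 n.+1) -/(index_iota 1 n.+1) big_add1 big_mkord. Qed.

Lemma null_grid_crossing (R : realType) (d : measure_display) (T : measurableType d)
    (mu : probability T R) (n K : nat) (Y : nat -> T -> R) (S : nat -> R) (b B : R) :
  null_model mu n Y ->
  S 0%N = 0 -> S K.+1 = 1 -> (forall k, (k <= K)%N -> S k <= S k.+1) ->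
  (forall k, (k <= K)%N -> S k < 1) -> 0 <= b ->
  (forall k, (k <= K)%N -> b * (S k / (1 - S k)) <= 1) -> 0 < B ->
  covered mu [set x | exists2 k, (1 <= k <= K)%N &
      let N := npv n (Y^~ x) (S k) in
      B <= (1 + b) ^+ N * (1 - b * (S k / (1 - S k))) ^+ (n - N)] B^-1.
Proof.
move=> [mY [iY uY]] S0 SK Smono Slt b0 bS B0.
have Sle j k : (j <= k <= K.+1)%N -> S j <= S k.
  elim: k => [|k IH]; first by rewrite leqn0 => /andP[/eqP ->].
  rewrite leq_eqVlt => /andP[/orP[/eqP -> //|jk] kK].
  by apply: le_trans (Smono k kK); apply: IH; rewrite -ltnS jk (ltnW kK).
(* The end sets are made empty and full so that the cells partition the whole line, although [Y] may
   leave the interval [0,1] on a null set; their probabilities are still S 0 = 0 and S (K + 1) =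
   1. *)
pose Q k : set R := if k == 0%N then set0 else if k == K.+1 then setT
                    else [set y | 1 - y <= S k].
have QE k : (1 <= k <= K)%N -> Q k = [set y | 1 - y <= S k].
  by rewrite /Q; case: k => // k /andP[_ kK]; rewrite /= ltn_eqF // ltnS.
have mQ k : measurable (Q k).
  rewrite /Q; case: ifP => // _; case: ifP => // _.
  rewrite (_ : [set y | _] = ~` [set y | y < 1 - S k]).
    by apply: measurableC; exact: measurable_ray_lt.
  by apply/seteqP; split => y /=; [move=> h; apply/negP|move=> /negP]; rewrite -leNgt; lra.
have Qsub j k : (j <= k <= K.+1)%N -> Q j `<=` Q k.
  move=> jk y; rewrite {1}/Q; case: ifP => // j0; case: ifP => [/eqP jK _|jK yj].
    have -> : k = K.+1 by move: jk; rewrite jK; clear; lia.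
    by rewrite /Q eqxx.
  rewrite /Q; case: ifP => [k0|_]; first by move: jk j0 k0; clear; lia.
  by case: ifP => // _; apply: le_trans (Sle _ _ jk).
have PQ t k : (1 <= t <= n)%N -> (k <= K.+1)%N -> prob mu (Y t @^-1` Q k) = S k.
  move=> tn kK; rewrite /Q; case: eqP => [->|k0].
    by rewrite preimage_set0 prob0.
  case: eqP => [->|kK']; first by rewrite preimage_setT probT.
  rewrite (_ : _ @^-1` _ = ~` (Y t @^-1` [set y | y < 1 - S k])); last first.
    by apply/seteqP; split => y /=; [move=> h; apply/negP|move=> /negP]; rewrite -leNgt; lra.
  rewrite probC; last exact: measurable_preimage (measurable_ray_lt _).
  have := Sle 0%N k; have := Sle k K.+1; rewrite S0 SK kK leqnn /= => /(_ isT) ? /(_ isT) ?.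
  rewrite uniform01_lt //; [lra|exact: uY|lra].
pose cell j : set R := Q j.+1 `\` Q j.
have mcell j : measurable (cell j) by exact: measurableD.
have Pcell t (j : 'I_K.+1) : (1 <= t <= n)%N ->
    prob mu (Y t @^-1` cell j) = S j.+1 - S j.
  move=> tn; have := probID mu (measurable_preimage (mY t) (mQ j.+1))
    (measurable_preimage (mY t) (mQ j)).
  rewrite PQ ?ltn_ord //.
  rewrite -preimage_setI (_ : Q j.+1 `&` Q j = Q j); last first.
    by apply/setIidPr; apply: Qsub; rewrite leqnSn /= ltn_ord.
  rewrite PQ //; last exact: ltnW.
  by rewrite -setDE -/(cell j) => ->; rewrite addrC addKr.
pose A (f : {ffun 'I_n -> 'I_K.+1}) t : set R :=
  oapp (fun i => cell (f i)) setT (insub t.-1).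
have AE (f : {ffun 'I_n -> 'I_K.+1}) (i : 'I_n) : A f i.+1 = cell (f i).
  by rewrite /A /= valK.
have mA f t : measurable (A f t).
  by rewrite /A; case: insub => //= i.
pose E' (f : {ffun 'I_n -> 'I_K.+1}) := [exists k : 'I_K.+1, B <= \prod_i cell_factor S b k (f i)].
(* [C f] prescribes the cell of every observation. By independence its probability is the
   multinomial weight of [f], and the crossing event lies in the union of the [C f] with [E' f]. *)
pose C f := \bigcap_(t in [set` iota 1 n]) (Y t @^-1` A f t).
have covC f : covered mu (C f) (\prod_i (S (f i).+1 - S (f i))).
  exists (C f); split => //.
    apply: fin_bigcap_measurable => // t _; exact: measurable_preimage.
  rewrite /prob (iY (iota 1 n) (iota_uniq _ _)) //; last first.
    by move=> t; rewrite mem_iota add1n ltnS.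
  have -> : \big[mule/1%E]_(i <- iota 1 n) mu (Y i @^-1` A f i) =
     \big[mule/1%E]_(i < n) mu (Y i.+1 @^-1` A f i.+1) by rewrite prod_iota1.
  rewrite (eq_bigr (fun i : 'I_n => (S (f i).+1 - S (f i))%:E)).
    by rewrite prodEFin.
  move=> i _; rewrite AE probE; last exact: measurable_preimage.
  by rewrite Pcell // ltn_ord.
have cov := @covered_seq _ _ _ mu _ [seq f <- enum {ffun 'I_n -> 'I_K.+1} | E' f] C
  (fun f => \prod_i (S (f i).+1 - S (f i))) (fun f _ => covC f).
apply: (covered_sub _ _ cov); last first.
  rewrite big_filter big_enum_cond /= -(ler_pM2l B0) mulfV ?gt_eqF //.
  exact: doob_cells.
move=> x /= [k kK]; set N := npv _ _ _ => BN.
have exf (i : 'I_n) : exists j : 'I_K.+1, cell j (Y i.+1 x).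
  have ex : exists k, `[< (k <= K.+1)%N /\ Q k (Y i.+1 x) >].
    by exists K.+1; apply/asboolP; rewrite /Q eqxx.
  case: (ex_minnP ex) => -[|m] /asboolP[mK Qm] min; first by rewrite /Q eqxx in Qm.
  exists (Ordinal mK); split => //= Qm'.
  by have := min m; rewrite ltnn asboolE => /(_ (conj (ltnW mK) Qm')).
have [f0 fE] := choice exf.
pose f := [ffun i => f0 i] : {ffun 'I_n -> 'I_K.+1}.
exists f; last first.
  move=> t /=; rewrite mem_iota add1n ltnS => /andP[t0 tn].
  have tn' : (t.-1 < n)%N by rewrite prednK.
  have -> : t = (Ordinal tn').+1 by rewrite /= prednK.
  by rewrite /preimage /= -[_.+1]/((Ordinal tn').+1) AE /f ffunE.
rewrite mem_filter mem_enum andbT; apply/existsP.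
have kK1 : (k < K.+1)%N by case/andP: kK.
exists (Ordinal kK1); apply: le_trans BN _; rewrite le_eqVlt; apply/orP; left; apply/eqP.
rewrite -[n in (n - N)%N](size_iota 1 n) -prod_if_count prod_iota1.
apply: eq_bigr => i _; rewrite /cell_factor /= /f ffunE.
suff -> : (f0 i < k)%N = (1 - Y i.+1 x <= S k) by [].
have [Q1 Q2] := fE i; have Qk : Q k = _ := QE k kK.
have [fk|kf] := ltnP (f0 i) k.
  have : Q k (Y i.+1 x) by apply: Qsub Q1; rewrite fk /= ltnW.
  by rewrite Qk /= => ->.
apply/esym/negbTE/negP => h; apply: Q2; apply: (Qsub k).
  by rewrite kf /= ltnW.
by rewrite Qk.
Qed.

(** Grid points are equally spaced in the odds s / (1 - s), so that z = b s / (1 - s) moves by 1 /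
    (4 n) per step. Moving s up to the next grid point only increases the count, and (1 - z)^(n - N)
    loses at most the factor (1 - 1 / (2 n))^n >= 1/2; hence the level B / 2 on the grid. *)
Lemma null_crossing (R : realType) (d : measure_display) (T : measurableType d)
    (mu : probability T R) (n : nat) (Y : nat -> T -> R) (b B : R) :
  null_model mu n Y -> (0 < n)%N -> 0 < b -> 0 < B ->
  covered mu [set x | exists s, [/\ 0 < s < 1, b * (s / (1 - s)) <= 2^-1 &
      let N := npv n (Y^~ x) s in
      B <= (1 + b) ^+ N * (1 - b * (s / (1 - s))) ^+ (n - N)]] (2 / B).
Proof.
move=> H0 n0 b0 B0.
have nR : 0 < n%:R :> R by rewrite ltr0n.
pose h : R := (4 * b * n%:R)^-1.
have h0 : 0 < h by rewrite invr_gt0 !mulr_gt0.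
have bh : b * h = (4 * n%:R)^-1 by rewrite /h; field; rewrite !gt_eqF.
(* 2 n + 1 steps of length 1 / (4 n) bring z past 1/2 while keeping it at most 1 on the grid. *)
pose K := (2 * n).+1.
pose S k : R := if (k <= K)%N then k%:R * h / (1 + k%:R * h) else 1.
have kh k : 0 <= k%:R * h by rewrite mulr_ge0 ?ler0n // ltW.
have oE k : (k <= K)%N -> S k / (1 - S k) = k%:R * h.
  move=> kK; rewrite /S kK; have := kh k => ?; field; rewrite !gt_eqF //; lra.
have SE k : (k <= K)%N -> S k = 1 - (1 + k%:R * h)^-1.
  by move=> kK; rewrite /S kK; have := kh k => ?; field; rewrite gt_eqF //; lra.
have bo k : (k <= K)%N -> b * (S k / (1 - S k)) = k%:R / (4 * n%:R).
  by move=> kK; rewrite oE // mulrCA bh.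
have kK2 k : (k <= K)%N -> k%:R / (4 * n%:R) <= 1 :> R.
  move=> kK; rewrite ler_pdivrMr ?mulr_gt0 //.
  have : k%:R <= K%:R :> R by rewrite ler_nat.
  have : 1 <= n%:R :> R by rewrite ler1n.
  by rewrite /K -natr1 natrM; lra.
have Slt k : (k <= K)%N -> S k < 1.
  by move=> kK; rewrite SE // gtrBl invr_gt0; have := kh k; lra.
have Smono k : (k <= K)%N -> S k <= S k.+1.
  move=> kK; case: (leqP k.+1 K) => kK1; last by rewrite {2}/S leqNgt kK1 /= ltW // Slt.
  rewrite !SE // lerD2l lerN2 lef_pV2 ?posrE; [|have := kh k.+1; lra|have := kh k; lra].
  by rewrite lerD2l ler_pM2r // ler_nat.
have B2 : 0 < B / 2 by lra.
have := @null_grid_crossing R d T mu n K Y S b (B / 2) H0.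
have -> : (B / 2)^-1 = 2 / B by rewrite invf_div.
move=> /(_ _ _ Smono Slt (ltW b0) _ B2) cov.
apply: (covered_sub _ (lexx _)) (cov _ _ _); last first.
- by move=> k kK; rewrite bo //; have := kK2 k kK; lra.
- by rewrite /S ltnn.
- by rewrite /S mul0r mul0r.
move=> x /= [s [s01 zle]]; set N := npv n (Y^~ x) s; set z := b * (s / (1 - s)) in zle * => BM.
have s1 : 0 < 1 - s by lra.
have o0 : 0 < s / (1 - s) by rewrite divr_gt0 //; lra.
set o := s / (1 - s) in o0 z zle BM.
have z0 : 0 < z by rewrite mulr_gt0.
pose k := (Num.truncn (o / h)).+1.
have /andP[kl ku] : (Num.truncn (o / h))%:R <= o / h < k%:R.
  by apply: truncn_itv; rewrite divr_ge0 // ltW.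
have zE : z = (o / h) / (4 * n%:R) by rewrite -bh /z; field; rewrite gt_eqF.
have kK : (k <= K)%N.
  rewrite /k /K !ltnS -(ler_nat R); apply: le_trans kl _; rewrite natrM.
  have : o / h = z * (4 * n%:R) by rewrite zE divfK // gt_eqF // mulr_gt0.
  by move=> ->; nra.
exists k => //; rewrite bo //.
have sS : s <= S k.
  have -> : s = 1 - (1 + o)^-1 by rewrite /o; field; rewrite subrK oner_eq0 gt_eqF.
  rewrite SE // lerD2l lerN2 lef_pV2 ?posrE; [|have := kh k; lra|lra].
  by rewrite lerD2l -ler_pdivrMr // ltW.
set N' := npv n (Y^~ x) (S k).
have NN' : (N <= N')%N by apply: sub_count => t /= /le_trans; apply.
have N'n : (N' <= n)%N by rewrite -[n](size_iota 1 n) count_size.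
set zk := k%:R / (4 * n%:R).
have zk1 : zk <= 1 by exact: kK2.
have zk0 : 0 <= zk by rewrite divr_ge0 // ler0n.
(* As z <= 1/2, the step 1 / (4 n) is at most (1 - z) / (2 n). *)
have zkz : (1 - z) * (1 - (2 * n%:R)^-1) <= 1 - zk.
  have : zk <= z + (4 * n%:R)^-1.
    rewrite zE /zk /k -natr1 mulrDl mul1r lerD2r ler_pM2r // invr_gt0 mulr_gt0 //.
  have -> : (4 * n%:R)^-1 = (2 * n%:R)^-1 / 2 :> R by field; rewrite gt_eqF.
  have : 0 < (2 * n%:R)^-1 :> R by rewrite invr_gt0 mulr_gt0.
  move: (2 * n%:R)^-1 => v v0 h1; nra.
have v01 : 0 <= (2 * n%:R : R)^-1 <= 1.
  rewrite invr_ge0 mulr_ge0 ?ler0n // invf_le1 ?mulr_gt0 //.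
  by rewrite -natrM ler1n muln_gt0.
have half : 2^-1 <= (1 - (2 * n%:R)^-1) ^+ (n - N) :> R.
  apply: (@le_trans _ _ ((1 - (2 * n%:R)^-1) ^+ n)); last first.
    by apply: ler_wiXn2l; [lra|lra|exact: leq_subr].
  apply: le_trans (bernoulli_ineq n v01).
  have -> : n%:R * (2 * n%:R)^-1 = 2^-1 :> R by field; rewrite gt_eqF.
  by lra.
have M0 : 0 <= (1 + b) ^+ N * (1 - z) ^+ (n - N) by rewrite mulr_ge0 ?exprn_ge0 //; lra.
apply: (@le_trans _ _ ((1 + b) ^+ N * ((1 - z) * (1 - (2 * n%:R)^-1)) ^+ (n - N))).
  rewrite exprMn mulrA; apply: (@le_trans _ _ ((1 + b) ^+ N * (1 - z) ^+ (n - N) / 2)); first by lra.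
  exact: ler_wpM2l.
apply: (@le_trans _ _ ((1 + b) ^+ N * (1 - zk) ^+ (n - N))).
  apply: ler_wpM2l; first by rewrite exprn_ge0 //; lra.
  by apply: lerXn2r => //; rewrite nnegrE ?mulr_ge0 //; lra.
(* Each of the N' - N additional points turns a factor 1 - zk <= 1 into 1 + b >= 1. *)
have nN' : (n - N = (n - N') + (N' - N))%N by rewrite addnBA // subnK.
rewrite nN' exprD mulrCA [leRHS]mulrC; apply: ler_wpM2l; first by rewrite exprn_ge0 //; lra.
rewrite -{2}(subnKC NN') exprD; apply: ler_wpM2l; first by rewrite exprn_ge0 //; lra.
by apply: lerXn2r => //; rewrite ?nnegrE; lra.
Qed.

(** * Higher Criticism under the null *)

Section SigmaAlgebra.
Context (T : Type) (F : set (set T)) (sF : sigma_algebra setT F).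

Lemma sigma_setC (A : set T) : F A -> F (~` A).
Proof. by move=> FA; rewrite -setTD; case: sF => _ h _; exact: h. Qed.

Lemma sigma_setU (A B : set T) : F A -> F B -> F (A `|` B).
Proof.
move=> FA FB; rewrite -bigcup2E; case: sF => F0 _; apply => -[|[|n]] //=.
Qed.

Lemma sigma_setI (A B : set T) : F A -> F B -> F (A `&` B).
Proof.
move=> FA FB; rewrite -[A `&` B]setCK setCI.
by apply: sigma_setC; apply: sigma_setU; exact: sigma_setC.
Qed.

Lemma sigma_setT : F setT.
Proof. by rewrite -setC0; apply: sigma_setC; case: sF. Qed.

Lemma sigma_exists (I : eqType) (r : seq I) (A : I -> set T) :
  (forall i, i \in r -> F (A i)) -> F [set x | exists2 i, i \in r & A i x].
Proof.
elim: r => [|i r IH] FA.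
  by rewrite (_ : [set x | _] = set0); [by case: sF|by apply/seteqP; split => // x []].
rewrite (_ : [set x | _] = A i `|` [set x | exists2 i, i \in r & A i x]).
  apply: sigma_setU; first by apply: FA; rewrite mem_head.
  by apply: IH => j jr; apply: FA; rewrite inE jr orbT.
apply/seteqP; split => x /= => [[j]|[Ai|[j jr Aj]]].
- by rewrite inE => /orP[/eqP -> Ai|jr Aj]; [left|right; exists j].
- by exists i; rewrite ?mem_head.
- by exists j; rewrite ?inE ?jr ?orbT.
Qed.

Lemma sigma_forall (I : eqType) (r : seq I) (A : I -> set T) :
  (forall i, i \in r -> F (A i)) -> F [set x | forall i, i \in r -> A i x].
Proof.
move=> FA; rewrite (_ : [set x | _] = ~` [set x | exists2 i, i \in r & (~` A i) x]).
  by apply: sigma_setC; apply: sigma_exists => i ir; apply: sigma_setC; exact: FA.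
apply/seteqP; split => x /= h.
  by move=> [i ir]; apply; exact: h.
by move=> i ir; apply: contrapT => nA; apply: h; exists i.
Qed.

(** Serves twice: with all measurable sets for measurability, and with the history for the
    conditional bounds. *)
Lemma sigma_count (I : eqType) (r : seq I) (Z : I -> T -> bool) (P : nat -> Prop) :
  (forall i, i \in r -> F [set x | Z i x]) -> F [set x | P (count (Z^~ x) r)].
Proof.
elim: r P => [|i r IH] P FZ /=.
  have [p|np] := pselect (P 0%N).
    by rewrite (_ : [set _ | _] = setT); [exact: sigma_setT|by apply/seteqP; split].
  by rewrite (_ : [set _ | _] = set0); [by case: sF|by apply/seteqP; split].
have Zi : F [set x | Z i x] by apply: FZ; rewrite mem_head.
have Zr j : j \in r -> F [set x | Z j x] by move=> jr; apply: FZ; rewrite inE jr orbT.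
rewrite (_ : [set _ | _] = ([set x | Z i x] `&` [set x | P (1 + count (Z^~ x) r)%N]) `|`
   (~` [set x | Z i x] `&` [set x | P (count (Z^~ x) r)])).
  apply: sigma_setU; apply: sigma_setI => //; last exact: IH.
    exact: (IH (fun m => P (1 + m)%N)).
  exact: sigma_setC.
apply/seteqP; split => x /=; case: (Z i x) => /=; rewrite ?add0n.
- by left.
- by right.
- by move=> [[] //|[]].
- by move=> [[] //|[]].
Qed.

End SigmaAlgebra.

(** * The statistic through counts of p-values *)

Section HigherCriticism.
Context (R : realType).
Implicit Types (n t : nat) (Y : nat -> R).

Lemma npv_le n Y s : (npv n Y s <= n)%N.
Proof. by rewrite /npv -[leqRHS](size_iota 1 n) count_size. Qed.

Lemma size_pvals n Y : size (pvals n Y) = n.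
Proof. by rewrite /pvals size_sort size_map size_iota. Qed.

Lemma sorted_pvals n Y : sorted <=%R (pvals n Y).
Proof. exact: sort_le_sorted. Qed.

Lemma count_pvals n Y s : count (<= s) (pvals n Y) = npv n Y s.
Proof.
rewrite /pvals (permP (permEl (perm_sort _ _))) count_map /npv.
by apply: eq_count.
Qed.

Lemma porder_le n Y t s : (1 <= t <= n)%N -> (porder n Y t <= s) = (t <= npv n Y s)%N.
Proof.
move=> /andP[t0 tn]; rewrite /porder tn -count_pvals.
have [h|h] := leqP t (count (<= s) (pvals n Y)).
  by apply: nth_count_le; rewrite ?sorted_pvals ?prednK.
apply/negbTE; rewrite -ltNge; apply: nth_count_gt; first exact: sorted_pvals.
by rewrite -ltnS prednK // h size_pvals.
Qed.

(** If the p-value is outside (0, 1), the denominator is the square root of a nonpositive number,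
    hence 0; the quotient is then 0 by convention and stays below a positive threshold. *)
Lemma HCnt_ge n Y t (thr : R) : (0 < n)%N -> 0 < thr ->
  (thr <= HCnt n Y t) = (0 < porder n Y t < 1) &&
   (n%:R * porder n Y t + thr * Num.sqrt (n%:R * porder n Y t * (1 - porder n Y t)) <= t%:R).
Proof.
move=> n0 thr0; rewrite /HCnt; set p := porder n Y t.
have nR : 0 < n%:R :> R by rewrite ltr0n.
have [pp|pp] := ltP 0 (p * (1 - p)); last first.
  rewrite (ler0_sqrtr pp) invr0 mulr0 leNgt thr0 /=; apply/esym/negbTE.
  by rewrite negb_and; apply/orP; left; apply/negP => ?; nra.
have -> : 0 < p < 1.
  by case: (ltP 0 p) => h /=; [case: (ltP p 1) => h' //|]; move: pp; nra.
have sq0 : 0 < Num.sqrt (p * (1 - p)) by rewrite sqrtr_gt0.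
have sn0 : 0 < Num.sqrt (n%:R : R) by rewrite sqrtr_gt0.
have -> : Num.sqrt (n%:R * p * (1 - p)) = Num.sqrt n%:R * Num.sqrt (p * (1 - p)).
  by rewrite -mulrA sqrtrM ?ler0n.
rewrite ler_pdivlMr // -(ler_pM2l sn0) /=.
have -> : Num.sqrt n%:R * (Num.sqrt n%:R * (t%:R / n%:R - p)) = t%:R - n%:R * p :> R.
  by rewrite mulrA -expr2 sqr_sqrtr ?ler0n // mulrBr mulrCA mulfV ?mulr1 // gt_eqF.
by rewrite lerBrDl mulrCA.
Qed.

Lemma HCplus_geP n (c : R) Y (thr : R) : (0 < n)%N -> 0 < thr ->
  (thr%:E <= HCplus n c Y)%E <->
  exists2 t, t \in iota 1 n & [/\ c <= porder n Y t.+1, 0 < porder n Y t < 1 &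
   n%:R * porder n Y t + thr * Num.sqrt (n%:R * porder n Y t * (1 - porder n Y t)) <= t%:R].
Proof.
move=> n0 thr0; rewrite /HCplus; split; last first.
  move=> [t tn [ct p01 h]]; have := (le_bigmax_seq -oo%E t
    (fun t => c <= porder n Y t.+1) (fun t => (HCnt n Y t)%:E) tn ct).
  apply: le_trans.
  by rewrite lee_fin HCnt_ge // p01 h.
elim: (iota 1 n) => [|t r IH]; first by rewrite big_nil leNgt ltNyr.
rewrite big_cons; case: ifP => ct.
  rewrite le_max => /orP[|/IH[t' t'r h]]; last by exists t' => //; rewrite inE t'r orbT.
  by rewrite lee_fin HCnt_ge // => /andP[p01 h]; exists t => //; rewrite mem_head.
by move=> /IH[t' t'r h]; exists t' => //; rewrite inE t'r orbT.
Qed.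

End HigherCriticism.

Section HCMeasurable.
Context (R : realType) (d : measure_display) (T : measurableType d).

Lemma measurable_sqrtr : measurable_fun [set: R] (@Num.sqrt R).
Proof. by apply: measurable_realfun.nondecreasing_measurable => // x y; exact: ler_wsqrtr. Qed.

Lemma measurable_porder (n t : nat) (Y : nat -> T -> R) :
  (forall t, measurable_fun setT (Y t)) -> (1 <= t)%N ->
  measurable_fun setT (fun x => porder n (Y^~ x) t).
Proof.
move=> mY t0; have [tn|nt] := leqP t n; last first.
  rewrite (_ : (fun x => _) = cst 1); first exact: measurable_cst.
  by apply/funext => x; rewrite /porder leqNgt nt.
apply: (measurability (@measurable_realfun.RGenOInfty.G R)) => [|/= _ [_] [a] -> <-].
  exact: measurable_realfun.RGenOInfty.measurableE.
rewrite setTI (_ : _ @^-1` _ = ~` [set x | (t <= npv n (Y^~ x) a)%N]).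
  apply: measurableC; rewrite /npv.
  apply: (sigma_count (sigma_algebra_measurable T) (Z := fun t x => 1 - Y t x <= a)
    (fun m => is_true (t <= m)%N)) => i _.
  rewrite (_ : [set _ | _] = ~` (Y i @^-1` [set y | y < 1 - a])).
    by apply: measurableC; apply: measurable_preimage => //; exact: measurable_ray_lt.
  by apply/seteqP; split => x /=; [move=> h; apply/negP|move=> /negP]; rewrite -leNgt; lra.
apply/seteqP; split => x /=; rewrite in_itv /= andbT ltNge porder_le ?t0 //.
  by move/negP.
by move=> h; apply/negP.
Qed.

Lemma measurable_HCplus_ge (n : nat) (c thr : R) (Y : nat -> T -> R) :
  (forall t, measurable_fun setT (Y t)) -> (0 < n)%N -> 0 < thr ->
  measurable [set x | (thr%:E <= HCplus n c (Y^~ x))%E].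
Proof.
move=> mY n0 thr0.
rewrite (_ : [set _ | _] = [set x | exists2 t, t \in iota 1 n &
  ([set x | c <= porder n (Y^~ x) t.+1] `&` ~` [set x | porder n (Y^~ x) t <= 0]
   `&` ~` [set x | 1 <= porder n (Y^~ x) t] `&` [set x |
   n%:R * porder n (Y^~ x) t +
   thr * Num.sqrt (n%:R * porder n (Y^~ x) t * (1 - porder n (Y^~ x) t)) <= t%:R]) x]).
  apply: (sigma_exists (sigma_algebra_measurable T)) => t.
  rewrite mem_iota => /andP[t0 _].
  have mp := measurable_porder n mY t0.
  have mp1 : measurable_fun setT (fun x => porder n (Y^~ x) t.+1) by exact: measurable_porder.
  have mle (f g : T -> R) : measurable_fun setT f -> measurable_fun setT g ->
     measurable [set x | f x <= g x].
    by move=> mf mg; rewrite -[X in measurable X]setTI; exact: measurable_fun_le.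
  apply: measurableI; first (apply: measurableI; first apply: measurableI).
  - by apply: mle => //; exact: measurable_cst.
  - by apply: measurableC; apply: mle => //; exact: measurable_cst.
  - by apply: measurableC; apply: mle => //; exact: measurable_cst.
  apply: mle; last exact: measurable_cst.
  apply: measurable_realfun.measurable_funD.
    by apply: measurable_realfun.measurable_funM => //; exact: measurable_cst.
  apply: measurable_realfun.measurable_funM; first exact: measurable_cst.
  apply: (measurableT_comp measurable_sqrtr).
  apply: measurable_realfun.measurable_funM.
    by apply: measurable_realfun.measurable_funM => //; exact: measurable_cst.
  by apply: measurable_realfun.measurable_funB => //; exact: measurable_cst.
apply/seteqP; split => x /=.
  move=> /(HCplus_geP _ _ n0 thr0)[t tn [ct /andP[p0 p1] h]]; exists t => //.
  by split => //; split; [split => //|]; apply/negP; rewrite -ltNge.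
move=> [t tn [[[ct /negP p0] /negP p1] h]]; apply/(HCplus_geP _ _ n0 thr0).
by exists t => //; split => //; rewrite !ltNge p0 p1.
Qed.

End HCMeasurable.

(** * Covering the null crossing event by blocks of sg *)

Lemma geometric_bracket (R : realType) (a v : R) (K : nat) :
  0 <= a -> 1 <= v -> v <= (1 + a) ^+ K ->
  exists2 k, (k < K.+1)%N & (1 + a) ^+ k <= v <= (1 + a) ^+ k.+1.
Proof.
move=> a0 v1; elim: K => [|K IH] vK.
  exists 0%N => //; rewrite expr0 v1 /= (le_trans vK) // expr0 expr1; lra.
have [/IH[k kK h]|h] := leP v ((1 + a) ^+ K); first by exists k => //; rewrite ltnW.
by exists K; rewrite // (ltW h) vK.
Qed.

(** With b sg = x v the main term is v - v^2 / 2, maximal at v = 1. The constant 19 adds up the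
    losses in units of a / 2: 1 from (v - 1)^2 / 2, 2 from v b / 2 and 16 from z v^2. *)
Lemma block_exponent (R : realType) (x a b v z : R) :
  0 < a <= 38^-1 -> 0 <= b <= a -> 1 <= v <= 1 + a -> z <= 2 * a ->
  x ^+ 2 / 2 * (1 - 19 * a) <= x * (x * v) * (1 - b / 2) - (1 + 2 * z) * (x * v) ^+ 2 / 2.
Proof.
move=> a01 ba va z2a.
have -> : x * (x * v) * (1 - b / 2) - (1 + 2 * z) * (x * v) ^+ 2 / 2 =
   x ^+ 2 * (v - v ^+ 2 / 2 - v * b / 2 - z * v ^+ 2) by field.
rewrite -mulrA; apply: ler_wpM2l; first exact: sqr_ge0.
have h1 : v * b <= 2 * a by apply: ler_pM; lra.
have v2 : v ^+ 2 <= 4 by nra.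
have h2 : z * v ^+ 2 <= 2 * a * 4.
  apply: (@le_trans _ _ (2 * a * v ^+ 2)); first by apply: ler_wpM2r => //; exact: sqr_ge0.
  by apply: ler_wpM2l => //; lra.
have h3 : (v - 1) ^+ 2 <= a by nra.
have : v - v ^+ 2 / 2 = 2^-1 - (v - 1) ^+ 2 / 2 by field.
lra.
Qed.

Lemma null_hc_covered (R : realType) (d : measure_display) (T : measurableType d)
    (mu : probability T R) (n K : nat) (Y : nat -> T -> R) (x a : R) :
  null_model mu n Y -> (0 < n)%N -> 1 <= x -> 0 < a <= 38^-1 -> x ^+ 2 / a ^+ 2 <= n%:R ->
  n%:R <= (1 + a) ^+ K ->
  covered mu [set w | exists s, [/\ 0 < s < 1, (0 < npv n (Y^~ w) s)%N &
     n%:R * s + x * Num.sqrt (n%:R * s * (1 - s)) <= (npv n (Y^~ w) s)%:R]]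
   (x^-1 + 2 / expR (a * Num.sqrt x / 8)
    + (K.+1)%:R * (2 / expR (x ^+ 2 / 2 * (1 - 19 * a))) + 2 / expR (a * x ^+ 2 / 8)).
Proof.
move=> H0 n0 x1 a01 xan nK.
have nR : 0 < n%:R :> R by rewrite ltr0n.
have x0 : 0 < x by lra.
have a0 : 0 < a by lra.
pose E b B := [set w | exists s, [/\ 0 < s < 1, b * (s / (1 - s)) <= 2^-1 &
      let N := npv n (Y^~ w) s in
      B <= (1 + b) ^+ N * (1 - b * (s / (1 - s))) ^+ (n - N)]].
have cE b B : 0 < b -> 0 < B -> covered mu (E b B) (2 / B).
  by move=> b0 B0; exact: null_crossing.
(* Left end of the k-th block of sg. The tilt x / [s0 k] gives b sg = x v with 1 <= v <= 1 + a on
   the block. *)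
pose s0 k := x / a * (1 + a) ^+ k.
have s00 k : 0 < s0 k by rewrite mulr_gt0 ?divr_gt0 ?exprn_gt0 //; lra.
have c0 : covered mu [set w | exists2 t, t \in iota 1 n & 1 - Y t w <= (x * n%:R)^-1] x^-1.
  have -> : x^-1 = \sum_(t <- iota 1 n) (x * n%:R)^-1.
    rewrite big_const_seq count_predT size_iota iter_addr_0 -mulr_natr.
    by field; rewrite !gt_eqF.
  apply: (covered_seq (E := fun t => [set w | 1 - Y t w <= (x * n%:R)^-1])) => t.
  rewrite mem_iota add1n ltnS => tn; have [mY [_ uY]] := H0.
  have mlt := measurable_preimage (mY t) (measurable_ray_lt (1 - (x * n%:R)^-1)).
  exists (~` (Y t @^-1` [set y | y < 1 - (x * n%:R)^-1])); split.
  - exact: measurableC.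
  - by move=> w /= h; apply/negP; rewrite -leNgt; lra.
  - have v0 : 0 < (x * n%:R)^-1 by rewrite invr_gt0 mulr_gt0.
    have v1 : (x * n%:R)^-1 <= 1.
      by rewrite invf_le1 ?mulr_gt0 // -[leLHS]mulr1 ler_pM // ler1n.
    rewrite probC // uniform01_lt //; [lra|exact: uY|lra].
(* Lower end: the tilt a / 2 keeps b sg <= x / 2 for all sg <= x / a. *)
have c1 := cE (a / 2) (expR (a * Num.sqrt x / 8)).
have c2 : covered mu [set w | exists2 k, k \in iota 0 K.+1 &
    E (x / s0 k) (expR (x ^+ 2 / 2 * (1 - 19 * a))) w]
    (K.+1%:R * (2 / expR (x ^+ 2 / 2 * (1 - 19 * a)))).
  have -> e : K.+1%:R * e = \sum_(k <- iota 0 K.+1) e :> R.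
    by rewrite big_const_seq count_predT size_iota iter_addr_0 mulr_natl.
  apply: (covered_seq (E := fun k => E (x / s0 k) _)) => k _; apply: cE; last exact: expR_gt0.
  by rewrite divr_gt0.
(* Upper end: this tilt gives b sg = (x / 2) (x sg / n), at most x / 2 because x sg <= n. *)
have c3 := cE (x ^+ 2 / (2 * n%:R)) (expR (a * x ^+ 2 / 8)).
have b3 : 0 < x ^+ 2 / (2 * n%:R) by rewrite divr_gt0 ?exprn_gt0 ?mulr_gt0.
have b1 : 0 < a / 2 by lra.
apply: covered_sub (lexx _) (coveredU (coveredU (coveredU c0 (c1 b1 (expR_gt0 _))) c2)
  (c3 b3 (expR_gt0 _))).
move=> w /= [s [s01 N0 Nge]]; set N := npv n (Y^~ w) s in N0 Nge.
have s1 : 0 < 1 - s by lra.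
have Nn : (N <= n)%N by exact: npv_le.
set o := s / (1 - s).
have o0 : 0 < o by rewrite divr_gt0 //; lra.
pose sg := Num.sqrt (n%:R * o).
have sg0 : 0 < sg by rewrite sqrtr_gt0 mulr_gt0.
have sgE : sg ^+ 2 = n%:R * o by rewrite sqr_sqrtr // mulr_ge0 // ltW.
have oE : o = sg ^+ 2 / n%:R by rewrite sgE mulrC mulKf // gt_eqF.
have x2n : x ^+ 2 <= n%:R * a ^+ 2 by rewrite -ler_pdivrMr // exprn_gt0.
have inE b B : 0 < b -> b <= 2^-1 -> b * o <= 2^-1 ->
    B <= x * (b * sg) * (1 - b / 2) - (1 + 2 * (b * o)) * (b * sg) ^+ 2 / 2 ->
    E b (expR B) w.
  move=> b0 b12 z12 BL; exists s; split => //=.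
  apply: le_trans (likelihood_ge (x := x) (sg := sg) _ _ s01 _ sgE z12 Nn Nge).
  - by rewrite ler_expR.
  - exact: ltW.
  - by rewrite b12 ltW.
  - exact: ltW.
(* A quarter of the linear term survives: three quarters remain after the correction by b, and the
   quadratic term takes at most one half. *)
have crude b : 0 < b -> b <= 2^-1 -> b * o <= 2^-1 -> b * sg <= x / 2 ->
    x * (b * sg) / 4 <= x * (b * sg) * (1 - b / 2) - (1 + 2 * (b * o)) * (b * sg) ^+ 2 / 2.
  move=> b0 b12 z12 u12.
  have u0 : 0 < b * sg by rewrite mulr_gt0.
  have z0 : 0 < b * o by rewrite mulr_gt0.
  move: (b * sg) (b * o) u0 z0 u12 z12 => u z u0 z0 u12 z12.
  have h1 : x * u * (3 / 4) <= x * u * (1 - b / 2).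
    by apply: ler_wpM2l; [rewrite mulr_ge0 // ltW|lra].
  have h2 : (1 + 2 * z) * u ^+ 2 <= 2 * u ^+ 2 by apply: ler_wpM2r; [exact: sqr_ge0|lra].
  have h3 : u ^+ 2 <= x / 2 * u by rewrite expr2; apply: ler_wpM2r => //; exact: ltW.
  lra.
have [lt0|ge0] := ltP (sg ^+ 2) x^-1.
  left; left; left; move: N0; rewrite /N /npv -has_count => /hasP[t tn ts].
  exists t => //; apply: le_trans ts _; rewrite invfM.
  have so : s <= o by rewrite /o ler_pdivlMr //; nra.
  apply: (le_trans so); rewrite oE; apply: ler_wpM2r; first by rewrite invr_ge0 ltW.
  exact: ltW.
have [le1|gt1] := leP sg (x / a).
  left; left; right; have sga : sg * a <= x by rewrite -ler_pdivlMr.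
  have b12 : a / 2 <= 2^-1 by lra.
  have z12 : a / 2 * o <= 2^-1.
    have : sg ^+ 2 <= n%:R.
      apply: le_trans xan; rewrite -expr_div_n; apply: lerXn2r => //.
        by rewrite nnegrE ltW.
      by rewrite nnegrE divr_ge0 // ltW.
    by rewrite oE mulrA ler_pdivrMr // => h; nra.
  apply: inE => //; apply: le_trans (crude _ b1 b12 z12 _); last by lra.
  have : Num.sqrt x <= x * sg.
    rewrite -[leRHS]gtr0_norm ?mulr_gt0 // -sqrtr_sqr; apply: ler_wsqrtr.
    rewrite exprMn; apply: (@le_trans _ _ (x ^+ 2 * x^-1)).
      by rewrite expr2 mulfK // gt_eqF.
    by apply: ler_wpM2l => //; exact: sqr_ge0.
  move: (Num.sqrt x) => r h; nra.
(* The count is at most n, so a crossing forces x sg (1 - s) <= n (1 - s); this bounds sg from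
   above. *)
have xsg : x * sg <= n%:R.
  have : x * (sg * (1 - s)) <= n%:R * (1 - s).
    have <- : Num.sqrt (n%:R * s * (1 - s)) = sg * (1 - s).
      have -> : n%:R * s * (1 - s) = (sg * (1 - s)) ^+ 2.
        by rewrite exprMn sgE /o; field; rewrite gt_eqF.
      by rewrite sqrtr_sqr gtr0_norm // mulr_gt0.
    have : (N%:R : R) <= n%:R by rewrite ler_nat.
    lra.
  by rewrite mulrA ler_pM2r.
have [le2|gt2] := leP (x * sg) (a * n%:R).
  left; right.
  have v1 : 1 <= sg / (x / a) by rewrite ler_pdivlMr ?divr_gt0 // mul1r ltW.
  have vK : sg / (x / a) <= (1 + a) ^+ K.
    apply: le_trans nK; rewrite ler_pdivrMr ?divr_gt0 //.
    apply: (@le_trans _ _ (x * sg)); first by rewrite ler_peMl // ltW.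
    apply: le_trans le2 _; rewrite mulrC; apply: ler_wpM2l; first exact: ltW.
    rewrite ler_pdivlMr //; nra.
  have [k kK /andP[kl ku]] := geometric_bracket (ltW a0) v1 vK.
  have {kl}kl : s0 k <= sg by rewrite /s0 mulrC -ler_pdivlMr // divr_gt0.
  have {ku}ku : sg <= s0 k * (1 + a).
    by rewrite /s0 -mulrA -exprSr mulrC -ler_pdivrMr // divr_gt0.
  have s0x : x / a <= s0 k.
    by rewrite ler_peMr ?(ltW (divr_gt0 x0 a0)) // exprn_ege1 // lerDl ltW.
  exists k; first by rewrite -[_ :: _]/(iota 0 K.+1) mem_iota.
  have ba : x / s0 k <= a by rewrite ler_pdivrMr // mulrC -ler_pdivrMr.
  have b0 : 0 < x / s0 k by rewrite divr_gt0.
  set v := sg / s0 k.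
  have v0 : 1 <= v by rewrite ler_pdivlMr // mul1r.
  have va : v <= 1 + a by rewrite ler_pdivrMr // mulrC.
  have zE : x / s0 k * o = v * (x * sg / n%:R).
    by rewrite oE /v; field; rewrite !gt_eqF.
  have y0 : 0 <= x * sg / n%:R by rewrite divr_ge0 ?mulr_ge0 // ltW.
  have ya : x * sg / n%:R <= a by rewrite ler_pdivrMr.
  have z2a : x / s0 k * o <= 2 * a.
    by rewrite zE; apply: ler_pM => //; clear -va v0 a01; lra.
  have uE : x / s0 k * sg = x * v by rewrite /v mulrAC -mulrA.
  apply: inE => //; [clear -ba a01; lra|clear -z2a a01; lra|].
  by rewrite uE; apply: block_exponent => //; rewrite ?v0 ?ba ?(ltW b0).
right.
have bE : x ^+ 2 / (2 * n%:R) * sg = x * (x * sg / n%:R) / 2 by field; rewrite gt_eqF.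
have b12 : x ^+ 2 / (2 * n%:R) <= 2^-1.
  rewrite ler_pdivrMr ?mulr_gt0 //; nra.
have r1 : x * sg / n%:R <= 1 by rewrite ler_pdivrMr // mul1r.
have r0 : 0 <= x * sg / n%:R by rewrite divr_ge0 ?mulr_ge0 // ltW.
have ra : a <= x * sg / n%:R by rewrite ler_pdivlMr // ltW.
have z12 : x ^+ 2 / (2 * n%:R) * o <= 2^-1.
  have -> : x ^+ 2 / (2 * n%:R) * o = (x * sg / n%:R) ^+ 2 / 2.
    by rewrite oE; field; rewrite gt_eqF.
  have : (x * sg / n%:R) ^+ 2 <= 1 by rewrite expr_le1.
  lra.
apply: inE => //; apply: le_trans (crude _ b3 b12 z12 _); last first.
  by rewrite bE; nra.
rewrite bE.
have -> : x * (x * (x * sg / n%:R) / 2) / 4 = x * sg / n%:R * x ^+ 2 / 8.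
  by field; rewrite gt_eqF.
by rewrite ler_pM2r // ler_wpM2r // sqr_ge0.
Qed.

(** * The watermark model *)

Lemma sigma_algebra_sub_measurable (d : measure_display) (T : measurableType d)
    (G : set (set T)) : (forall A, G A -> measurable A) -> forall A, <<s G >> A -> measurable A.
Proof.
move=> Gm; apply: smallest_sub; first exact: sigma_algebra_measurable.
exact: Gm.
Qed.

(** * Conditional lower bounds and the lower tail of a count *)

Section ConditionalBounds.
Context (R : realType) (d : measure_display) (T : measurableType d) (mu : probability T R).

Lemma prob_partition (W : eqType) (r : seq W) (w : T -> W) (X : set T) :
  uniq r -> measurable X -> (forall v, measurable (w @^-1` [set v])) ->
  \sum_(v <- r) prob mu (X `&` w @^-1` [set v]) <= prob mu X.
Proof.
move=> ur mX mw.
have mr (s : seq W) : measurable [set x | w x \in s].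
  rewrite (_ : [set _ | _] = [set x | exists2 v, v \in s & (w @^-1` [set v]) x]).
    by apply: (sigma_exists (sigma_algebra_measurable T)
      (A := fun v => w @^-1` [set v])) => v _; exact: mw.
  by apply/seteqP; split => x /= => [h|[v vs ->]//]; exists (w x).
suff -> : \sum_(v <- r) prob mu (X `&` w @^-1` [set v]) = prob mu (X `&` [set x | w x \in r]).
  by apply: le_prob => //; exact: measurableI.
elim: r ur => [|v r IH] /=.
  by rewrite big_nil (_ : _ `&` _ = set0) ?prob0 //; apply/seteqP; split => // x [].
move=> /andP[vr ur]; rewrite big_cons IH // -probU; [|exact: measurableI|exact: measurableI|].
  congr prob; rewrite -setIUr; congr (_ `&` _); apply/seteqP; split => x /=.
    by rewrite inE => -[->|->]; rewrite ?eqxx ?orbT.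
  by rewrite inE => /orP[/eqP|]; [left|right].
by apply/seteqP; split => // x /= [[_ ->] [_]]; rewrite (negPf vr).
Qed.

(** A conditional lower bound may be checked on each piece of a cover from [F]: peeling the pieces
    off one by one makes them disjoint. The pieces will fix which tokens are top and minor. *)
Lemma prob_ge_cover (F : set (set T)) (V : set T) (pi : R) (I : eqType) (r : seq I)
    (C : I -> set T) :
  sigma_algebra setT F -> (forall A, F A -> measurable A) -> measurable V ->
  (forall i, i \in r -> F (C i)) ->
  (forall i E, i \in r -> F E -> E `<=` C i -> pi * prob mu E <= prob mu (V `&` E)) ->
  forall E, F E -> E `<=` [set x | exists2 i, i \in r & C i x] ->
    pi * prob mu E <= prob mu (V `&` E).
Proof.
move=> sF Fm mV; elim: r => [|i r IH] FC H E FE EC.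
  have -> : E = set0 by apply/seteqP; split => // x /EC[].
  by rewrite setI0 prob0 mulr0.
have FCi : F (C i) by apply: FC; rewrite mem_head.
have FE1 : F (E `&` C i) by exact: sigma_setI.
have FE2 : F (E `&` ~` C i) by apply: (sigma_setI sF) => //; exact: sigma_setC.
rewrite (probID mu (Fm _ FE) (Fm _ FCi)) mulrDr.
rewrite (probID mu (measurableI _ _ mV (Fm _ FE)) (Fm _ FCi)) -!setIA.
apply: lerD; first by apply: (H i) => //; rewrite mem_head.
apply: IH => //.
- by move=> j jr; apply: FC; rewrite inE jr orbT.
- by move=> j E' jr; apply: H; rewrite inE jr orbT.
- by move=> x [/EC[j]]; rewrite inE => /orP[/eqP -> //|jr Cj _]; exists j.
Qed.

(** A truncated Laplace transform: given the past, q^Z has mean at most 1 - (1 - q) pi. The past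
    enters only through the current count, and the values below K are all that the tail bound
    needs. *)
Lemma count_laplace (Z : nat -> T -> bool) (pi q : R) (m K : nat) :
  (forall t, measurable [set x | Z t x]) -> 0 <= q <= 1 -> 0 <= pi <= 1 ->
  (forall j k, (j < m)%N ->
    let A := [set x | count (Z^~ x) (iota 2 j) = k] in
    pi * prob mu A <= prob mu ([set x | Z j.+2 x] `&` A)) ->
  \sum_(k < K) q ^+ k * prob mu [set x | count (Z^~ x) (iota 2 m) = k]
    <= (1 - (1 - q) * pi) ^+ m.
Proof.
move=> mZ q01 pi01; elim: m => [|m IH] H.
  rewrite expr0; case: K => [|K]; first by rewrite big_ord0.
  rewrite big_ord_recl expr0 mul1r big1 ?addr0.
    rewrite -(probT mu); apply: le_prob => //.
    by apply: (sigma_count (sigma_algebra_measurable T) (fun m => m = 0%N)).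
  move=> i _; rewrite (_ : [set x | _] = set0) ?prob0 ?mulr0 //.
  by apply/seteqP; split.
pose A k := [set x | count (Z^~ x) (iota 2 m) = k].
pose V := [set x | Z m.+2 x].
have mA k : measurable (A k).
  by apply: (sigma_count (sigma_algebra_measurable T) (fun m => m = k)).
have mV : measurable V by exact: mZ.
have mVA k : measurable (V `&` A k) by exact: measurableI.
have iotaS : iota 2 m.+1 = rcons (iota 2 m) m.+2.
  by rewrite -cats1 -[m.+2]add2n -[[:: _]]/(iota (2 + m) 1) -iotaD addn1.
rewrite {}iotaS.
have split k : prob mu [set x | count (Z^~ x) (rcons (iota 2 m) m.+2) = k] <=
   (prob mu (A k) - prob mu (V `&` A k)) +
   (if k is k'.+1 then prob mu (V `&` A k') else 0).
  have E1 : prob mu (A k `&` ~` V) = prob mu (A k) - prob mu (V `&` A k).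
    by have := probID mu (mA k) mV; rewrite setIC; lra.
  rewrite -E1; have mD : measurable (A k `&` ~` V).
    by apply: measurableI => //; exact: measurableC.
  have mcnt : measurable [set x | count (Z^~ x) (rcons (iota 2 m) m.+2) = k].
    by apply: (sigma_count (sigma_algebra_measurable T) (fun m => m = k)).
  case: k mcnt mD {E1} => [|k] mcnt mD.
    rewrite addr0; apply: le_prob => // x /=; rewrite -cats1 count_cat /= /V /A /=.
    by case: (Z m.+2 x); rewrite ?addn1 // !addn0; split.
  apply: le_trans (probU_le mu mD (mVA k)); apply: le_prob => //; first exact: measurableU.
  move=> x /=; rewrite -cats1 count_cat /= /V /A /=.
  case: (Z m.+2 x); rewrite ?addn1 ?addn0 => h; [right|left]; split => //.
  by case: h.
apply: (@le_trans _ _ (\sum_(k < K) q ^+ k * (prob mu (A k) - prob mu (V `&` A k)) +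
    \sum_(k < K) q ^+ k.+1 * prob mu (V `&` A k))).
  apply: (@le_trans _ _ (\sum_(k < K) (q ^+ k * (prob mu (A k) - prob mu (V `&` A k)) +
     q ^+ k * (if (k : nat) is k'.+1 then prob mu (V `&` A k') else 0)))).
    apply: ler_sum => k _; rewrite -mulrDr; apply: ler_wpM2l; first by rewrite exprn_ge0 //; lra.
    exact: split.
  rewrite big_split /= lerD2l.
  case: K {IH} => [|K]; first by rewrite !big_ord0.
  rewrite big_ord_recl /= mulr0 add0r [leRHS]big_ord_recr /= ler_wpDr //.
  by rewrite mulr_ge0 ?prob_ge0 ?exprn_ge0 //; lra.
rewrite exprS -big_split /=; apply: le_trans (ler_wpM2l _ (IH _)); last 2 first.
- nra.
- by move=> j k jm; apply: H; exact: ltnW.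
rewrite mulr_sumr; apply: ler_sum => k _; rewrite exprSr.
have qk : 0 <= q ^+ k by rewrite exprn_ge0 //; lra.
have zA : pi * prob mu (A k) <= prob mu (V `&` A k) by exact: H.
move: (prob mu (A k)) (prob mu (V `&` A k)) (q ^+ k) zA qk => a z c zA c0.
have -> : c * (a - z) + c * q * z = c * (a - (1 - q) * z) by ring.
have -> : (1 - (1 - q) * pi) * (c * a) = c * (a - (1 - q) * (pi * a)) by ring.
apply: ler_wpM2l => //; rewrite lerD2l lerN2; apply: ler_wpM2l => //; lra.
Qed.

(** Chernoff bound with q = exp (- lam): Markov's inequality costs q^(-K), and 1 - q >= lam - lam^2
    follows from exp (- lam) <= 1 / (1 + lam). *)
Lemma count_lower_tail (Z : nat -> T -> bool) (pi lam : R) (m K : nat) :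
  (forall t, measurable [set x | Z t x]) -> 0 <= lam <= 1 -> 0 <= pi <= 1 ->
  (forall j k, (j < m)%N ->
    let A := [set x | count (Z^~ x) (iota 2 j) = k] in
    pi * prob mu A <= prob mu ([set x | Z j.+2 x] `&` A)) ->
  prob mu [set x | (count (Z^~ x) (iota 2 m) < K)%N] <=
    expR (lam * K%:R - (lam - lam ^+ 2) * (pi * m%:R)).
Proof.
move=> mZ lam01 pi01 H.
have q0 : 0 < expR (- lam) := expR_gt0 _.
have q1 : expR (- lam) <= 1 by rewrite -expR0 ler_expR; lra.
have qe : lam - lam ^+ 2 <= 1 - expR (- lam).
  have h : expR (- lam) <= (1 + lam)^-1.
    rewrite expRN lef_pV2 ?posrE ?expR_gt0 ?expR_ge1Dx //; lra.
  have : (1 + lam)^-1 <= 1 - lam + lam ^+ 2.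
    rewrite invf_ple ?posrE; [|lra|nra].
    rewrite -[leLHS]mul1r ler_pdivrMr; nra.
  lra.
have q01 : 0 <= expR (- lam) <= 1 by rewrite ltW.
have main := count_laplace K mZ q01 pi01 H.
set q := expR (- lam) in q0 q1 qe q01 main.
apply: (@le_trans _ _ (q ^- K * (1 - (1 - q) * pi) ^+ m)).
  have iq : 0 < q ^- K by rewrite invr_gt0 exprn_gt0.
  apply: le_trans (ler_wpM2l (ltW iq) main); rewrite mulr_sumr.
  apply: (@le_trans _ _ (\sum_(k < K) prob mu [set x | count (Z^~ x) (iota 2 m) = k])).
    have mc k : measurable [set x | count (Z^~ x) (iota 2 m) = k].
      by apply: (sigma_count (sigma_algebra_measurable T) (fun m => m = k)).
    have := @covered_seq _ _ _ mu _ (enum 'I_K)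
      (fun k => [set x | count (Z^~ x) (iota 2 m) = k]) (fun k => prob mu [set x | count (Z^~ x) (iota 2 m) = k]).
    rewrite big_enum /= => cov; apply: covered_le.
      by apply: (sigma_count (sigma_algebra_measurable T) (fun m => is_true (m < K)%N)).
    apply: (covered_sub _ (lexx _)) (cov _).
      by move=> x /= h; exists (Ordinal h); rewrite ?mem_enum.
    by move=> k _; exists [set x | count (Z^~ x) (iota 2 m) = k]; split.
  apply: ler_sum => k _; rewrite mulrA ler_peMl ?prob_ge0 //.
  rewrite mulrC ler_pdivlMr ?exprn_gt0 // mul1r; apply: ler_wiXn2l; [exact: ltW|by []|exact: ltnW].
have -> : q ^- K = expR (lam * K%:R).
  by rewrite -exprVn -expRN opprK expRM_natr.
rewrite expRD; apply: ler_wpM2l; first exact: expR_ge0.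
have -> : - ((lam - lam ^+ 2) * (pi * m%:R)) = (- ((lam - lam ^+ 2) * pi)) * m%:R by ring.
rewrite expRM_natr; apply: lerXn2r; rewrite ?nnegrE ?expR_ge0 //; first by nra.
apply: le_trans (expR_ge1Dx _); rewrite lerD2l lerN2; apply: ler_wpM2r => //; lra.
Qed.

End ConditionalBounds.

(** The witness is t = N(s): the next order statistic exceeds s, hence the cut-off, while p_(t) <=
    s. Counting only p-values in (0, s) makes p_(t) positive. The inequality passes from s down to
    p_(t) because (t - n p) / sqrt (p (1 - p)) decreases in p when t <= n. *)
Lemma HCplus_power (R : realType) (n : nat) (Y : nat -> R) (c s thr : R) (k : nat) :
  (0 < n)%N -> 0 < thr -> 0 < s < 1 -> c <= s -> (0 < k)%N ->
  (k <= count (fun t => (1 - s < Y t < 1)%R) (iota 1 n))%N ->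
  n%:R * s + thr * Num.sqrt (n%:R * s * (1 - s)) <= k%:R ->
  (thr%:E <= HCplus n c Y)%E.
Proof.
move=> n0 thr0 s01 cs k0 kc hk; apply/(HCplus_geP _ _ n0 thr0).
pose t := npv n Y s.
have cnt : (npv n Y 0 + count (fun t => (1 - s < Y t < 1)%R) (iota 1 n) <= t)%N.
  rewrite /t /npv -count_predUI [X in (_ + X)%N](_ : _ = 0%N) ?addn0.
    by apply: sub_count => u /= /orP[|/andP[]]; lra.
  by apply/eqP; rewrite -leqn0 leqNgt -has_count; apply/negP => /hasP[u _ /=]; lra.
have kt : (k <= t)%N by apply: leq_trans kc _; apply: leq_trans cnt; exact: leq_addl.
have tn : (1 <= t <= n)%N by rewrite (leq_trans k0 kt) npv_le.
have ps : porder n Y t <= s by rewrite porder_le.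
have p0 : 0 < porder n Y t.
  rewrite ltNge porder_le // -ltnNge; apply: leq_trans cnt.
  by rewrite -addn1 leq_add2l (leq_trans k0 kc).
exists t; first by rewrite mem_iota add1n ltnS.
have nR : 0 < n%:R :> R by rewrite ltr0n.
have p1 : porder n Y t < 1 by lra.
have hk' : n%:R * s + thr * Num.sqrt (n%:R * s * (1 - s)) <= t%:R.
  by apply: le_trans hk _; rewrite ler_nat.
have tnR : t%:R <= n%:R :> R by rewrite ler_nat; case/andP: tn.
split => //; last first.
- have {tnR hk'} : forall p : R, 0 < p -> p <= s ->
    n%:R * p + thr * Num.sqrt (n%:R * p * (1 - p)) <= t%:R.
    move: (n%:R : R) (t%:R : R) nR tnR hk' => N g N0 gN hs p {}p0 {}ps.
    have sE y : Num.sqrt (N * y * (1 - y)) = Num.sqrt N * Num.sqrt (y * (1 - y)).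
      by rewrite -mulrA sqrtrM // ltW.
    rewrite !sE in hs *.
    have sN0 : 0 < Num.sqrt N by rewrite sqrtr_gt0.
    have ss0 : 0 < Num.sqrt (s * (1 - s)) by rewrite sqrtr_gt0 mulr_gt0 //; lra.
    have sp0 : 0 < Num.sqrt (p * (1 - p)) by rewrite sqrtr_gt0 mulr_gt0 //; lra.
    have gs : 0 <= g - N * s.
      by have : 0 <= thr * (Num.sqrt N * Num.sqrt (s * (1 - s))); [rewrite !mulr_ge0 // ltW|lra].
    have gp : 0 <= g - N * p by nra.
    (* [h1] rests on g <= N and [h2] on g >= 0; their product is the square of [h3]. The variance p
       (1 - p) itself need not increase on (0, s]. *)
    have h1 : (g - N * s) * (1 - p) <= (g - N * p) * (1 - s) by nra.
    have h2 : (g - N * s) * p <= (g - N * p) * s by nra.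
    have h3 : (g - N * s) * Num.sqrt (p * (1 - p)) <= (g - N * p) * Num.sqrt (s * (1 - s)).
      rewrite -(ler_pXn2r (ltn0Sn 1)) ?nnegrE ?mulr_ge0 ?(ltW ss0) ?(ltW sp0) //.
      rewrite !exprMn !sqr_sqrtr ?mulr_ge0 //; try lra.
      have h21 : (g - N * s) * p * ((g - N * s) * (1 - p)) <=
          (g - N * p) * s * ((g - N * p) * (1 - s)).
        by apply: ler_pM => //; rewrite mulr_ge0 //; lra.
      have -> : (g - N * s) ^+ 2 * (p * (1 - p)) = (g - N * s) * p * ((g - N * s) * (1 - p)).
        by ring.
      by have -> : (g - N * p) ^+ 2 * (s * (1 - s)) = (g - N * p) * s * ((g - N * p) * (1 - s));
        [ring|].
    have h4 : thr * (Num.sqrt N * Num.sqrt (s * (1 - s))) * Num.sqrt (p * (1 - p)) <=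
        (g - N * s) * Num.sqrt (p * (1 - p)).
      by apply: ler_wpM2r; [exact: ltW|lra].
    have h5 : thr * (Num.sqrt N * Num.sqrt (p * (1 - p))) * Num.sqrt (s * (1 - s)) <=
        (g - N * p) * Num.sqrt (s * (1 - s)).
      apply: le_trans h3; apply: le_trans h4; rewrite le_eqVlt; apply/orP; left.
      by apply/eqP; ring.
    by move: h5; rewrite ler_pM2r // lerBrDl.
  by apply.
- by rewrite p0.
apply: (le_trans cs); have [tn'|nt] := leqP t.+1 n; last by rewrite /porder leqNgt nt /= ltW; lra.
by rewrite ltW // ltNge porder_le ?tn' // ltnn.
Qed.

(** * Deterministic facts on Gumbel-max decoding *)

Section Gumbel.
Context (R : realType) (W : finType).
Implicit Types (P V : W -> R).

Lemma probvec_le1 P v : probvec P -> P v <= 1.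
Proof.
move=> [P0 P1]; rewrite -P1 (bigD1 v) //= lerDl.
by apply: sumr_ge0.
Qed.

Lemma gscore_real P V i w : 0 < P i -> (gscore P V i <= gscore P V w)%E ->
  0 < P w /\ ln (V i) / P i <= ln (V w) / P w.
Proof.
by move=> Pi; rewrite /gscore Pi; case: ifP => [Pw|_]; rewrite ?lee_fin // leeNy_eq.
Qed.

Lemma probvec_max_gt0 P i : probvec P -> (forall v, P v <= P i) -> 0 < P i.
Proof.
move=> [P0 P1] Pmax; rewrite ltNge; apply/negP => Pi.
suff : \sum_w P w <= 0 by rewrite P1; lra.
by apply: sumr_le0 => v _; apply: le_trans (Pmax v) Pi.
Qed.

(** The winner satisfies ln V_w >= (P_w / P_i) ln V_i >= ln V_i, since P_w <= P_i and ln V_i < 0: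
    its uniform is at least that of the most likely token. *)
Lemma gumbel_top_token P V (D : R) i w : probvec P -> (forall v, P v <= P i) ->
  gumbel_argmax P V w -> (forall u, 0 < V u < 1) -> 1 - D < V i -> 1 - D < V w < 1.
Proof.
move=> pP Pmax gw V01 Vi.
have Pi := probvec_max_gt0 pP Pmax.
have [Pw h] := gscore_real Pi (gw i).
have /andP[Vw0 Vw1] := V01 w; have /andP[Vi0 Vi1] := V01 i.
rewrite Vw1 andbT; apply: (lt_le_trans Vi).
rewrite -(ler_ln (R := R)) ?posrE //.
have lnVi : ln (V i) <= 0 by apply: ln_le0; exact: ltW.
have : ln (V i) / P i * P w <= ln (V w) by rewrite -ler_pdivlMr.
apply: le_trans; rewrite mulrAC -mulrA.
have r1 : P w / P i <= 1 by rewrite ler_pdivrMr // mul1r.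
by have : 0 <= (- ln (V i)) * (1 - P w / P i); [rewrite mulr_ge0 //; lra|lra].
Qed.

(** For D <= 1 one has 1 - D / 2 >= 1 / (1 + D) >= exp (- D), so token j scores at least -|W|, while
    any other token scores at most -(|W| + 1). *)
Lemma gumbel_minor_token P V (D : R) j w : probvec P -> 0 < D <= 1 ->
  D / #|W|%:R <= P j -> gumbel_argmax P V w -> 1 - D / 2 < V j < 1 ->
  (forall u, u != j -> 0 < V u <= expR (- (#|W|.+1)%:R)) -> w = j.
Proof.
move=> pP D01 Pj gw Vj Vu; apply/eqP/negP => /negP wj.
have m0 : 0 < #|W|%:R :> R by rewrite ltr0n; apply/card_gt0P; exists j.
have Pj0 : 0 < P j by apply: lt_le_trans Pj; rewrite divr_gt0 //; lra.
have [Pw h] := gscore_real Pj0 (gw j).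
have /andP[Vw0 Vw] := Vu w wj.
have lw : ln (V w) <= - (#|W|.+1)%:R.
  by rewrite -[leRHS]expRK ler_ln ?posrE ?expR_gt0.
have lw' : ln (V w) / P w <= - (#|W|.+1)%:R.
  rewrite ler_pdivrMr //; apply: le_trans lw _.
  have := probvec_le1 w pP; have : 0 <= (#|W|.+1)%:R :> R by rewrite ler0n.
  move: (#|W|.+1)%:R => m; nra.
have lj : - D <= ln (V j).
  rewrite -[leLHS]expRK ler_ln ?posrE ?expR_gt0 //; last lra.
  apply: (@le_trans _ _ (1 + D)^-1).
    by rewrite expRN lef_pV2 ?posrE ?expR_gt0 ?expR_ge1Dx //; lra.
  apply: (@le_trans _ _ (1 - D / 2)); last by lra.
  rewrite invf_ple ?posrE; [|lra|lra].
  by rewrite -[leLHS]mul1r ler_pdivrMr; nra.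
have lj' : - #|W|%:R <= ln (V j) / P j.
  rewrite ler_pdivlMr //; apply: le_trans lj.
  by rewrite mulNr lerN2 -ler_pdivrMl // mulrC.
have := le_trans lj' (le_trans h lw'); rewrite -natr1; lra.
Qed.

(** Pigeonhole: the tokens other than the top one carry mass at least D. *)
Lemma exists_top_minor P (D : R) : probvec P -> in_PDelta D P -> 0 < D ->
  exists i j, [/\ (forall v, P v <= P i), i != j & D / #|W|%:R <= P j].
Proof.
move=> pP PD D0.
have [i0 _|W0] := pickP (@predT W); last first.
  by have [_] := pP; rewrite big_pred0 // => /eqP; rewrite eq_sym oner_eq0.
have m0 : 0 < #|W|%:R :> R by rewrite ltr0n; apply/card_gt0P; exists i0.
pose i := [arg max_(i > i0) P i]%O.
have Pmax v : P v <= P i by rewrite /i; case: arg_maxP => // k _; apply.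
exists i; have [j /andP[ij Pj]|none] := pickP [pred j | (i != j) && (D / #|W|%:R <= P j)].
  by exists j.
exfalso; have [P0 P1] := pP.
have le v : v != i -> P v <= D / #|W|%:R.
  by move=> vi; have := none v; rewrite /= eq_sym vi /= => /negbT; rewrite -ltNge => /ltW.
have : \sum_(v | v != i) P v <= \sum_(v | v != i) (D / #|W|%:R) by exact: ler_sum.
rewrite sumr_const cardC1 -[_ *+ #|W|.-1]mulr_natl.
move: P1; rewrite (bigD1 i) //= => P1.
have := PD i; have mE : #|W|%:R = #|W|.-1%:R + 1 :> R.
  by rewrite natr1 prednK //; apply/card_gt0P; exists i0.
have -> : #|W|.-1%:R * (D / #|W|%:R) = D - D / #|W|%:R.
  by rewrite [in RHS]mE mE; field; rewrite -mE gt_eqF.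
have : 0 < D / #|W|%:R by rewrite divr_gt0.
lra.
Qed.

(** Summing over the tokens gives 1 <= |W| (1 - D). The bound makes the two winning boxes below
    disjoint: a uniform cannot exceed 1 - D and be at most exp (- (|W| + 1)). *)
Lemma PDelta_gap P (D : R) : probvec P -> in_PDelta D P ->
  expR (- (#|W|.+1)%:R) <= 1 - D.
Proof.
move=> [P0 P1] PD.
have [i0 _|W0] := pickP (@predT W); last first.
  by move: P1; rewrite big_pred0 // => /eqP; rewrite eq_sym oner_eq0.
have m0 : 0 < #|W|%:R :> R by rewrite ltr0n; apply/card_gt0P; exists i0.
have : 1 <= #|W|%:R * (1 - D).
  have : \sum_v P v <= \sum_(v : W) (1 - D) by exact: ler_sum.
  by rewrite P1 sumr_const -[_ *+ #|_|]mulr_natl.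
rewrite -ler_pdivrMl // mulr1; apply: le_trans.
rewrite expRN lef_pV2 ?posrE ?expR_gt0 //; apply: le_trans (expR_ge1Dx _).
by rewrite -natr1; lra.
Qed.

End Gumbel.

(* Half the probability that all tokens but one draw a uniform below exp (- (|W| + 1)). *)
Definition kappa (R : realType) (W : finType) : R :=
  expR (- (#|W|.+1)%:R) ^+ #|W|.-1 / 2.

(** * Conditional probability of a small p-value in the model *)

Section WatermarkModel.
Context (R : realType) (W : finType) (d : measure_display) (T : measurableType d)
  (mu : probability T R) (n : nat) (eps D : R)
  (Pt : nat -> T -> W -> R) (U : nat -> T -> W -> R) (wt : nat -> T -> W).
Context (HA : assumptionA mu n eps Pt U wt) (HD : as_PDelta mu n D Pt)
  (n0 : (0 < n)%N) (D0 : 0 < D) (eps0 : 0 < eps).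

Let Z t x := (1 - D < U t x (wt t x) < 1).

Let mU : forall t w, measurable_fun setT (fun x => U t x w). Proof. by case: HA. Qed.
Let mP : forall t w, measurable_fun setT (fun x => Pt t x w). Proof. by case: HA => _ []. Qed.
Let mw : forall t v, measurable (wt t @^-1` [set v]). Proof. by case: HA => _ [_ []]. Qed.
Let pP : forall t x, (1 <= t <= n)%N -> probvec (Pt t x).
Proof. by case: HA => _ [_ [_ []]]. Qed.
Let uU : forall t w, (1 <= t <= n)%N -> uniform01 mu (fun x => U t x w).
Proof. by case: HA => _ [_ [_ [_ [_ []]]]]. Qed.
Let xiH : forall t, (1 <= t <= n)%N -> indep_sys mu (sigma_xi U t) (hist Pt U wt t).
Proof. by case: HA => _ [_ [_ [_ [_ [_ []]]]]]. Qed.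

Lemma watermark_measurable t : measurable_fun setT (fun x => U t x (wt t x)).
Proof.
move=> _ A mA; rewrite setTI.
rewrite (_ : _ @^-1` _ = [set x | exists2 v, v \in enum W &
   (wt t @^-1` [set v] `&` (fun x => U t x v) @^-1` A) x]).
  apply: (sigma_exists (sigma_algebra_measurable T)
    (A := fun v => wt t @^-1` [set v] `&` (fun x => U t x v) @^-1` A)) => v _.
  by apply: measurableI => //; exact: measurable_preimage.
apply/seteqP; split => x /= => [h|[v _ [<- //]]].
by exists (wt t x); rewrite ?mem_enum.
Qed.

Let sH t : sigma_algebra setT (hist Pt U wt t). Proof. exact: smallest_sigma_algebra. Qed.
Let sX t : sigma_algebra setT (sigma_xi U t). Proof. exact: smallest_sigma_algebra. Qed.

Let hist_measurable t A : hist Pt U wt t A -> measurable A.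
Proof.
apply: sigma_algebra_sub_measurable => {}A [j [_ [[v ->]//|[[v [B [mB ->]]]|[v [B [mB ->]]]]]]].
  exact: measurable_preimage.
exact: measurable_preimage.
Qed.

Let xi_measurable t A : sigma_xi U t A -> measurable A.
Proof.
apply: sigma_algebra_sub_measurable => {}A [v [B [mB ->]]].
exact: measurable_preimage.
Qed.

Let hist_Z t j : (1 <= j < t)%N -> hist Pt U wt t [set x | Z j x].
Proof.
move=> jt; rewrite (_ : [set _ | _] = [set x | exists2 v, v \in enum W &
   (wt j @^-1` [set v] `&` (fun x => U j x v) @^-1` [set y | 1 - D < y < 1]) x]).
  apply: (sigma_exists (sH t) (A := fun v => wt j @^-1` [set v] `&`
    (fun x => U j x v) @^-1` [set y | 1 - D < y < 1])) => v _.
  apply: (sigma_setI (sH t)); apply: sub_sigma_algebra; exists j; split => //.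
    by left; exists v.
  right; left; exists v; exists [set y | 1 - D < y < 1]; split => //.
  by rewrite -set_itvoo; exact: measurable_itv.
apply/seteqP; split => x /= => [h|[v _ [<- //]]].
by exists (wt j x); rewrite ?mem_enum.
Qed.

Let hist_Pge t v (a : R) : (2 <= t)%N -> hist Pt U wt t [set x | a <= Pt t x v].
Proof.
case: t => [|[|t]] // _; apply: sub_sigma_algebra; exists t.+1; split; first by rewrite ltnSn.
right; right; exists v; exists [set y | a <= y]; split => //.
by rewrite -set_itvcy; exact: measurable_itv.
Qed.

(** Comparing two coordinates is not a generator of the history, so the history is made a measurable
    type in which both coordinates are measurable functions. *)
Let hist_Ple t v i : (2 <= t)%N -> hist Pt U wt t [set x | Pt t x v <= Pt t x i].
Proof.
case: t => [|[|t]] // _.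
pose T' := g_sigma_algebraType (hist_gen Pt U wt t.+2).
have mf u : measurable_fun (setT : set T') (fun x : T' => Pt t.+2 x u).
  move=> _ A mA; rewrite setTI; apply: sub_sigma_algebra; exists t.+1.
  split; first by rewrite ltnSn.
  by right; right; exists u; exists A.
have := measurable_fun_le measurableT (mf v) (mf i).
by rewrite setTI.
Qed.

Let rect_xi t (A : W -> set R) : (forall v, measurable (A v)) ->
  sigma_xi U t [set x | forall v, v \in enum W -> A v (U t x v)].
Proof.
move=> mA; apply: (sigma_forall (sX t) (A := fun v => (fun x => U t x v) @^-1` A v)) => v _.
by apply: sub_sigma_algebra; exists v; exists (A v).
Qed.

Let rect_prob t (A : W -> set R) : (1 <= t <= n)%N -> (forall v, measurable (A v)) ->
  prob mu [set x | forall v, v \in enum W -> A v (U t x v)] =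
  \prod_v prob mu ((fun x => U t x v) @^-1` A v).
Proof.
move=> tn mA; have [_ [_ [_ [_ [iU _]]]]] := HA.
have := iU [seq (t, v) | v <- enum W] _ _ (fun tv => A tv.2) (fun tv => mA tv.2).
rewrite (_ : \bigcap_(i in _) _ = [set x | forall v, v \in enum W -> A v (U t x v)]); last first.
  apply/seteqP; split => x /= h.
    by move=> v vW; apply: (h (t, v)) => /=; apply/mapP; exists v.
  by move=> tv /= /mapP[v vW ->] /=; exact: h.
rewrite big_map big_enum /= /prob => ->.
- rewrite (eq_bigr (fun v => (prob mu ((fun x => U t x v) @^-1` A v))%:E)).
    by rewrite prodEFin.
  by move=> v _; rewrite -probE //; exact: measurable_preimage.
- by rewrite map_inj_uniq ?enum_uniq // => u v [].
- by move=> tv /mapP[v _ ->].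
Qed.

(** The exceptional null set is not the whole space; one good sample point suffices to bound the
    deterministic number D away from 1. *)
Let nonnull : exists x : T, forall t, (1 <= t <= n)%N -> in_PDelta D (Pt t x).
Proof.
have [N [mN [N0 HN]]] := HD.
have [NT|/existsNP[x Nx]] := pselect (forall x, N x); last by exists x => t; exact: HN.
have : prob mu N = 1 by rewrite (_ : N = setT) ?probT //; apply/seteqP; split.
by rewrite /prob N0 => /eqP; rewrite eq_sym oner_eq0.
Qed.

Let gap : expR (- (#|W|.+1)%:R) <= 1 - D.
Proof.
have [x Hx] := nonnull; have n1 : (1 <= 1 <= n)%N by [].
exact: PDelta_gap (pP x n1) (Hx _ n1).
Qed.

Let D1 : D < 1. Proof. by have := gap; have := expR_gt0 (- (#|W|.+1)%:R : R); lra. Qed.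

Lemma watermark_Delta_lt1 : D < 1. Proof. exact: D1. Qed.

(** Boxes of uniforms to which [gumbel_top_token] and [gumbel_minor_token] apply; their
    probabilities are D and [kappa] D. *)
Let A1 (i : W) v : set R := if v == i then [set y | 1 - D < y < 1] else [set y | 0 < y < 1].
Let A2 (j : W) v : set R := if v == j then [set y | 1 - D / 2 < y < 1]
  else [set y | 0 < y <= expR (- (#|W|.+1)%:R)].
Let box (A : W -> set R) t := [set x | forall v, v \in enum W -> A v (U t x v)].
Let H i j t := box (A1 i) t `|` box (A2 j) t.

Let mA1 i v : measurable (A1 i v).
Proof.
rewrite /A1; case: ifP => _; rewrite -set_itvoo; exact: measurable_itv.
Qed.

Let mA2 j v : measurable (A2 j v).
Proof.
by rewrite /A2; case: ifP => _; rewrite -?set_itvoo -?set_itvoc; exact: measurable_itv.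
Qed.

Let H_xi i j t : sigma_xi U t (H i j t).
Proof. by apply: (sigma_setU (sX t)); apply: rect_xi. Qed.

Let prob_H i j t : (1 <= t <= n)%N -> i != j -> prob mu (H i j t) = D + kappa R W * D.
Proof.
move=> tn ij; have e0 := expR_gt0 (- (#|W|.+1)%:R : R); have d1 := D1; have d0 := D0.
have mbox A : (forall v, measurable (A v)) -> measurable (box A t).
  by move=> mA; apply: (@xi_measurable t); exact: rect_xi.
rewrite /H probU; [|exact: mbox|exact: mbox|]; last first.
  apply/seteqP; split => // x /= [h1 h2].
  have := h1 i; have := h2 i; rewrite mem_enum => /(_ isT) + /(_ isT).
  by rewrite /A1 /A2 eqxx (negPf ij) /=; have := gap; lra.
congr (_ + _).
  rewrite /box rect_prob // (bigD1 i) //= /A1 eqxx uniform01_oo //; [|exact: uU|lra|lra].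
  rewrite big1 ?mulr1; first by lra.
  move=> v /negPf vi; rewrite vi uniform01_oo //; [lra|exact: uU].
rewrite /box rect_prob // (bigD1 j) //= /A2 eqxx uniform01_oo //; [|exact: uU|lra|lra].
rewrite (eq_bigr (fun=> expR (- (#|W|.+1)%:R))).
  by rewrite prodr_const cardC1 /kappa; set e := _ ^+ _; lra.
move=> v /negPf vj; have e1 : expR (- (#|W|.+1)%:R) <= 1 :> R by have := gap; lra.
by rewrite vj (uniform01_oc (mU t v) (uU v tn) (lexx 0) (expR_ge0 _) e1) subr0.
Qed.

(** The pair of a top and a minor token is read off from the past, so the box [H i j t] is fixed
    before the uniforms of time t are drawn. *)
Let C t (ij : W * W) := [set x | forall v, v \in enum W -> Pt t x v <= Pt t x ij.1] `&`
  [set x | D / #|W|%:R <= Pt t x ij.2].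

Let hist_C t ij : (2 <= t)%N -> hist Pt U wt t (C t ij).
Proof.
move=> t2; apply: (sigma_setI (sH t)); last exact: hist_Pge.
apply: (sigma_forall (sH t) (A := fun v => [set x | Pt t x v <= Pt t x ij.1])) => v _.
exact: hist_Ple.
Qed.

Let mZ t : measurable [set x | Z t x].
Proof.
have := measurable_preimage (watermark_measurable t) (measurable_itv `]1 - D, 1[).
by rewrite set_itvoo.
Qed.

Let decoder_bound t B E : (2 <= t <= n)%N -> measurable B -> mu B = eps%:E ->
  indep_sys mu [set B] (<<s hist_gen Pt U wt t `|` xi_gen U t >>) ->
  (forall x, B x -> gumbel_argmax (Pt t x) (U t x) (wt t x)) ->
  hist Pt U wt t E ->
  eps * (D + kappa R W * D) * prob mu E <= prob mu ([set x | Z t x] `&` B `&` E).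
Proof.
move=> /andP[t2 tn] mB Beps iB gB FE.
have tn1 : (1 <= t <= n)%N by rewrite tn ltnW.
have mE := hist_measurable FE.
set pi := eps * _; set V := [set x | Z t x] `&` B.
have mV : measurable V by exact: measurableI.
pose r := [seq ij <- enum {: W * W} | ij.1 != ij.2].
have [N [mN [N0 HN]]] := HD.
pose E' := E `&` [set x | exists2 ij, ij \in r & C t ij x].
have FC : hist Pt U wt t [set x | exists2 ij, ij \in r & C t ij x].
  by apply: (sigma_exists (sH t) (A := C t)) => ij _; exact: hist_C.
have FE' : hist Pt U wt t E' by exact: (sigma_setI (sH t)).
have EE' : prob mu E = prob mu E'.
  rewrite (probID mu mE (hist_measurable FC)) -/E' -[RHS]addr0; congr (_ + _).
  apply/eqP; rewrite eq_le prob_ge0 andbT.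
  have <- : prob mu N = 0 by rewrite /prob N0.
  apply: le_prob => //.
    by apply: measurableI => //; apply: measurableC; exact: hist_measurable FC.
  move=> x [_ nC]; apply: contrapT => Nx; apply: nC.
  have [i [j [Pmax ij Pj]]] := exists_top_minor (pP x tn1) (HN x Nx t tn1) D0.
  exists (i, j); first by rewrite /r mem_filter mem_enum ij.
  by split => //= v _; exact: Pmax.
rewrite EE'; apply: (@le_trans _ _ (prob mu (V `&` E'))); last first.
  apply: le_prob; [|exact: measurableI|by move=> x [? []]].
  by apply: measurableI => //; exact: hist_measurable FE'.
apply: (prob_ge_cover (sH t) (@hist_measurable t) mV (C := C t) (r := r) _ _ FE'); last first.
- by move=> x [].
- move=> [i j] E1; rewrite mem_filter /= => /andP[ij _] FE1 EC.
  have mE1 := hist_measurable FE1.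
  have FH : <<s hist_gen Pt U wt t `|` xi_gen U t >> (H i j t `&` E1).
    have sG : sigma_algebra setT (<<s hist_gen Pt U wt t `|` xi_gen U t >>).
      exact: smallest_sigma_algebra.
    apply: (sigma_setI sG).
      have sub1 : sigma_xi U t `<=` <<s hist_gen Pt U wt t `|` xi_gen U t >>.
        by apply: smallest_sub => // A' ?; apply: sub_sigma_algebra; right.
      by apply: sub1; exact: H_xi.
    have sub2 : hist Pt U wt t `<=` <<s hist_gen Pt U wt t `|` xi_gen U t >>.
      by apply: smallest_sub => // A' ?; apply: sub_sigma_algebra; left.
    exact: sub2.
  have mHE : measurable (H i j t `&` E1).
    by apply: measurableI => //; apply: (@xi_measurable t); exact: H_xi.
  (* [B] is independent of the past and the uniforms jointly, and these are independent of each
     other, so the three probabilities multiply. *)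
  have -> : pi * prob mu E1 = prob mu (B `&` (H i j t `&` E1)).
    rewrite /prob (iB _ _ erefl FH) Beps (xiH tn1 (@H_xi i j t) FE1).
    rewrite (probE mu (xi_measurable (@H_xi i j t))) prob_H // (probE mu mE1).
    by rewrite -!EFinM /= /pi mulrA.
  apply: le_prob; [exact: measurableI|exact: measurableI|].
  move=> x [Bx [Hx Ex]]; split => //; split => //=.
  have [/= Pmax Pj] := EC _ Ex.
  have Pmax' v : Pt t x v <= Pt t x i by apply: Pmax; rewrite mem_enum.
  case: Hx => /= Hx.
    apply: (gumbel_top_token (pP x tn1) Pmax' (gB x Bx)).
      move=> u; have := Hx u; rewrite mem_enum => /(_ isT); rewrite /A1.
      by case: ifP => _ //=; have := D1; have := D0; lra.
    by have := Hx i; rewrite mem_enum => /(_ isT); rewrite /A1 eqxx /= => /andP[].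
  have Vj : 1 - D / 2 < U t x j < 1.
    by have := Hx j; rewrite mem_enum => /(_ isT); rewrite /A2 eqxx.
  have Vu u : u != j -> 0 < U t x u <= expR (- (#|W|.+1)%:R).
    by move=> /negPf uj; have := Hx u; rewrite mem_enum => /(_ isT); rewrite /A2 uj.
  have D01 : 0 < D <= 1 by rewrite D0 ltW ?D1.
  by rewrite /Z (gumbel_minor_token (pP x tn1) D01 Pj (gB x Bx) Vj Vu); have := D0; lra.
- by move=> ij _; exact: hist_C.
Qed.

(** Without the decoder, the sampled token is independent of the uniforms: each token contributes a
    factor D, and the entries of P_t sum to 1 under the integral. *)
Let plain_bound t B E : (2 <= t <= n)%N -> measurable B ->
  (forall (v : W) E A, hist Pt U wt t E -> sigma_xi U t A ->
           mu (~` B `&` (wt t @^-1` [set v]) `&` E `&` A)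
           = ((1 - eps)%:E * mu A * \int[mu]_(x in E) (Pt t x v)%:E)%E) ->
  hist Pt U wt t E ->
  (1 - eps) * D * prob mu E <= prob mu ([set x | Z t x] `&` ~` B `&` E).
Proof.
move=> /andP[t2 tn] mB HB FE.
have tn1 : (1 <= t <= n)%N by rewrite tn ltnW.
have mE := hist_measurable FE.
pose A v := (fun x => U t x v) @^-1` [set y | 1 - D < y < 1].
have FA v : sigma_xi U t (A v).
  apply: sub_sigma_algebra; exists v; exists [set y | 1 - D < y < 1]; split => //.
  by rewrite -set_itvoo; exact: measurable_itv.
have d1 := D1; have d0 := D0.
have PA v : mu (A v) = D%:E.
  rewrite (probE mu (xi_measurable (FA v))) uniform01_oo //; [|exact: uU|lra|lra].
  by congr EFin; lra.
set X := _ `&` _ `&` _; have mX : measurable X.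
  apply: measurableI => //; apply: measurableI => //; exact: measurableC.
apply: le_trans (prob_partition mu (enum_uniq W) mX (mw t)).
rewrite big_enum /=.
have XE v : X `&` wt t @^-1` [set v] = ~` B `&` (wt t @^-1` [set v]) `&` E `&` A v.
  apply/seteqP; split => x /=; rewrite /X /A /Z /=.
    by move=> [[[Zx Bx] Ex] wv]; split => //; rewrite -wv.
  by move=> [[[Bx wv] Ex] Ax]; split => //; split => //; split => //; rewrite wv.
have int0 v : (0 <= \int[mu]_(x in E) (Pt t x v)%:E)%E.
  by apply: integral_ge0 => x _; rewrite lee_fin; case: (pP x tn1).
rewrite -lee_fin EFinM -probE // -sumEFin.
rewrite (eq_bigr (fun v => (((1 - eps) * D)%:E * \int[mu]_(x in E) (Pt t x v)%:E)%E)).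
  rewrite -ge0_sume_distrr; last by move=> v _.
  rewrite -ge0_integral_sum //; last 2 first.
  - move=> v; apply/measurable_realfun.measurable_EFinP; apply: measurable_funTS; exact: mP.
  - by move=> v x _; rewrite lee_fin; case: (pP x tn1).
  rewrite (eq_integral (cst 1%E)) ?integral_cst ?mul1e //.
  by move=> x _; rewrite sumEFin; case: (pP x tn1) => _ ->.
move=> v _; rewrite -probE; last by apply: measurableI.
by rewrite XE HB // PA EFinM.
Qed.

Let eps1 : eps <= 1.
Proof.
have [_ [_ [_ [_ [_ [_ [_ [B HB]]]]]]]] := HA.
have [mB Beps _ _ _] := HB 1%N n0.
by rewrite -lee_fin -Beps probability_le1.
Qed.

Lemma watermark_eps_le1 : eps <= 1. Proof. exact: eps1. Qed.

Let cond_bound t E : (2 <= t <= n)%N -> hist Pt U wt t E ->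
  D * (1 + eps * kappa R W) * prob mu E <= prob mu ([set x | Z t x] `&` E).
Proof.
move=> tn FE; have /andP[t2 tn2] := tn.
have tn1 : (1 <= t <= n)%N by rewrite tn2 ltnW.
have [_ [_ [_ [_ [_ [_ [_ [B HB]]]]]]]] := HA.
have [mB Beps iB gB HBc] := HB t tn1.
have mE := hist_measurable FE.
have mZE : measurable ([set x | Z t x] `&` E) by exact: measurableI.
rewrite (probID mu mZE mB) [in X in _ <= X + _]setIAC [in X in _ <= _ + X]setIAC.
have := decoder_bound tn mB Beps iB gB FE; have := plain_bound tn mB HBc FE.
move: (prob mu E) (prob mu _) (prob mu _) => e a b h1 h2.
by apply: le_trans (lerD h2 h1); rewrite le_eqVlt; apply/orP; left; apply/eqP; ring.
Qed.

Lemma watermark_count_tail (lam : R) (K : nat) : (1 < n)%N -> 0 <= lam <= 1 ->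
  prob mu [set x | (count (Z^~ x) (iota 2 n.-1) < K)%N] <=
    expR (lam * K%:R - (lam - lam ^+ 2) * (D * (1 + eps * kappa R W) * n.-1%:R)).
Proof.
move=> n2 lam01.
have k0 : 0 <= kappa R W by rewrite mulr_ge0 ?invr_ge0 ?exprn_ge0 ?expR_ge0.
have pi0 : 0 <= D * (1 + eps * kappa R W).
  by rewrite mulr_ge0 ?addr_ge0 ?mulr_ge0 //; exact: ltW.
(* The conditional bound on the whole space places pi below a probability. *)
have pi1 : D * (1 + eps * kappa R W) <= 1.
  have := cond_bound (n2 : (2 <= 2 <= n)%N) (sigma_setT (sH 2)).
  rewrite probT mulr1 setIT => /le_trans; apply.
  by rewrite -(probT mu); apply: le_prob.
apply: count_lower_tail => //; first by rewrite pi0 pi1.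
move=> j k jn /=; apply: cond_bound; first by rewrite /= -[n]prednK.
apply: (sigma_count (sH j.+2) (fun m => m = k)) => t.
by rewrite mem_iota add2n => /andP[t2 tj]; apply: hist_Z; rewrite tj ltnW.
Qed.

End WatermarkModel.

(** * Asymptotics *)

Lemma kappa_gt0 (R : realType) (W : finType) : 0 < kappa R W.
Proof. by rewrite /kappa divr_gt0 // exprn_gt0 // expR_gt0. Qed.

Lemma kappa_le1 (R : realType) (W : finType) : kappa R W <= 1.
Proof.
have : expR (- (#|W|.+1)%:R) ^+ #|W|.-1 <= 1 :> R.
  rewrite exprn_ile1 ?expR_ge0 // -expR0 ler_expR oppr_le0 ler0n //.
by rewrite /kappa; lra.
Qed.

Lemma hc_type1 (R : realType) (d : measure_display) (T : measurableType d)
    (mu : probability T R) (n K : nat) (Y : nat -> T -> R) (c x a : R) :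
  null_model mu n Y -> (0 < n)%N -> 1 <= x -> 0 < a <= 38^-1 -> x ^+ 2 / a ^+ 2 <= n%:R ->
  n%:R <= (1 + a) ^+ K ->
  prob mu [set w | (x%:E <= HCplus n c (Y^~ w))%E] <=
   x^-1 + 2 / expR (a * Num.sqrt x / 8)
    + (K.+1)%:R * (2 / expR (x ^+ 2 / 2 * (1 - 19 * a))) + 2 / expR (a * x ^+ 2 / 8).
Proof.
move=> H0 n0 x1 a01 xan nK; have x0 : 0 < x by lra.
apply: covered_le; first by apply: measurable_HCplus_ge => //; case: H0.
apply: (covered_sub _ (lexx _)) (null_hc_covered H0 n0 x1 a01 xan nK).
move=> w /= /(HCplus_geP _ _ n0 x0)[t]; rewrite mem_iota add1n ltnS => tn [_ p01 h].
have tN : (t <= npv n (Y^~ w) (porder n (Y^~ w) t))%N by rewrite -porder_le.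
exists (porder n (Y^~ w) t); split => //; first by apply: leq_trans tN; case/andP: tn.
by apply: le_trans h _; rewrite ler_nat.
Qed.

Lemma hc_type2 (R : realType) (W : finType) (d : measure_display) (T : measurableType d)
    (mu : probability T R) (n : nat) (eps D c thr : R)
    (Pt : nat -> T -> W -> R) (U : nat -> T -> W -> R) (wt : nat -> T -> W) :
  assumptionA mu n eps Pt U wt -> as_PDelta mu n D Pt ->
  (1 < n)%N -> 0 < D -> 0 < eps -> 0 < thr -> c <= D ->
  12 / kappa R W <= n%:R * eps ^+ 2 * D ->
  thr ^+ 2 <= kappa R W ^+ 2 * (n%:R * eps ^+ 2 * D) / 4 ->
  prob mu [set x | (HCplus n c (fun t => U t x (wt t x)) < thr%:E)%E] <=
    expR (- (kappa R W ^+ 2 * (n%:R * eps ^+ 2 * D) / 128)).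
Proof.
move=> HA HD n2 D0 eps0 thr0 cD X12 thrX.
have n0 : (0 < n)%N by exact: ltnW.
have D1 := watermark_Delta_lt1 HA HD n0.
have eps1 := watermark_eps_le1 HA n0.
have nR : 0 < n%:R :> R by rewrite ltr0n.
set k := kappa R W in X12 thrX *.
have k0 : 0 < k by exact: kappa_gt0.
have k1 : k <= 1 by exact: kappa_le1.
(* The relative excess eps [kappa] is 16 lam, so the mean is about n D + 16 g and the level [y] lies
   half way. The exponent is at most - 8 g lam + 2 g lam + 3 lam, where 3 lam pays for rounding K up
   and for the dropped first token; as 3 <= 4 g, it is at most - 2 g lam, which is the stated
   exponent. *)
set lam := eps * k / 16.
have ek : eps * k <= 1 := mulr_ile1 (ltW eps0) (ltW k0) eps1 k1.
have ek0 : 0 < eps * k by rewrite mulr_gt0.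
have lam01 : 0 <= lam <= 1 by rewrite /lam; lra.
pose g := n%:R * D * lam.
have gX : g * lam * 256 = k ^+ 2 * (n%:R * eps ^+ 2 * D) by rewrite /g /lam; field.
have g34 : 3 <= 4 * g.
  have h : 12 <= k * (n%:R * eps ^+ 2 * D) by rewrite mulrC -ler_pdivrMr.
  have : k * (n%:R * eps ^+ 2 * D) <= 16 * g.
    have -> : 16 * g = k * (n%:R * eps * D) by rewrite /g /lam; field.
    rewrite ler_wpM2l ?(ltW k0) // ler_wpM2r ?(ltW D0) // ler_wpM2l ?(ltW nR) //.
    by rewrite expr2 ler_piMl // ltW.
  lra.
pose y := n%:R * D + 8 * g.
have g0 : 0 < g by lra.
have nD0 : 0 < n%:R * D by rewrite mulr_gt0.
pose K := (Num.truncn y).+1.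
have /andP[Kl Ku] : (Num.truncn y)%:R <= y < K%:R.
  by apply: truncn_itv; rewrite /y; lra.
have mY t := watermark_measurable HA t.
have mge : measurable [set x | (thr%:E <= HCplus n c (fun t => U t x (wt t x)))%E].
  exact: (@measurable_HCplus_ge R d T n c thr (fun t x => U t x (wt t x))).
pose Z t (x : T) := 1 - D < U t x (wt t x) < 1.
apply: (@le_trans _ _ (prob mu [set x | (count (Z^~ x) (iota 2 n.-1) < K)%N])).
  apply: le_prob.
  - rewrite (_ : [set _ | _] = ~` [set x | (thr%:E <= HCplus n c (fun t => U t x (wt t x)))%E]).
      exact: measurableC.
    by apply/seteqP; split => x /=; [move=> h; apply/negP|move=> /negP]; rewrite -ltNge.
  - apply: (sigma_count (sigma_algebra_measurable T)
      (Z := Z) (fun m => is_true (m < K)%N)) => t _.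
    have := measurable_preimage (mY t) (measurable_itv `]1 - D, 1[).
    by rewrite set_itvoo.
  - move=> x /=; rewrite ltNge => /negP h; rewrite ltnNge; apply/negP => Kc; apply: h.
    apply: (@HCplus_power _ n (fun t => U t x (wt t x)) c D thr K) => //; first lra.
      apply: leq_trans Kc _; rewrite -[in leqRHS](prednK n0) /=; exact: leq_addl.
    apply: le_trans (ltW Ku); rewrite /y lerD2l.
    have sq : Num.sqrt (n%:R * D * (1 - D)) ^+ 2 <= n%:R * D.
      have h1 : 0 <= 1 - D by lra.
      have h2 : 1 - D <= 1 by lra.
      by rewrite sqr_sqrtr ?(mulr_ge0 (ltW nD0) h1) // ler_piMr // ltW.
    have g8 : 0 <= 8 * g by lra.
    have ts : 0 <= thr * Num.sqrt (n%:R * D * (1 - D)) := mulr_ge0 (ltW thr0) (sqrtr_ge0 _).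
    (* After squaring, (8 g)^2 = 64 g lam n D is exactly the assumed bound on the squared threshold
       times n D. *)
    rewrite -(ler_pXn2r (ltn0Sn 1)) ?nnegrE //.
    rewrite exprMn; apply: (@le_trans _ _ (g * lam * 256 / 4 * (n%:R * D))).
      by rewrite gX; apply: ler_pM; rewrite ?sqr_ge0.
    by rewrite /g; lra.
apply: (le_trans (watermark_count_tail HA HD n0 D0 eps0 K n2 lam01)).
rewrite ler_expR -/k -gX.
have n1E : n.-1%:R = n%:R - 1 :> R by rewrite -subn1 natrB.
have ekE : eps * k = 16 * lam by rewrite /lam; field.
rewrite n1E ekE.
have KK : K%:R <= y + 1 by rewrite /K -natr1 lerD2r.
have lK : lam * K%:R <= lam * (n%:R * D + 8 * g + 1) by rewrite ler_wpM2l //; case/andP: lam01.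
have ek1 : 16 * lam <= 1 by rewrite -ekE.
have l0 : 0 <= lam by case/andP: lam01.
have E : D * (1 + 16 * lam) * (n%:R - 1) = n%:R * D + 16 * g - D * (1 + 16 * lam).
  by rewrite /g; ring.
have pi2 : D * (1 + 16 * lam) <= 2 by nra.
have pi0 : 0 <= D * (1 + 16 * lam) by rewrite mulr_ge0 ?(ltW D0) //; lra.
rewrite E; move: (D * (1 + 16 * lam)) pi2 pi0 => pi pi2 pi0.
have h1 : lam ^+ 2 * (n%:R * D + 16 * g - pi) <= lam ^+ 2 * (2 * (n%:R * D)).
  apply: ler_wpM2l; first exact: sqr_ge0.
  have : 16 * g <= n%:R * D by rewrite /g; nra.
  lra.
have h2 : lam ^+ 2 * (2 * (n%:R * D)) = 2 * (g * lam) by rewrite /g; ring.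
have h3 : lam * (3 - 4 * g) <= 0 by rewrite mulr_ge0_le0 //; lra.
have h4 : lam * pi <= lam * 2 by rewrite ler_wpM2l.
lra.
Qed.

(** * Error bounds uniform over the probability spaces *)

Lemma inv_expR_le (R : realType) (v : R) : 0 < v -> (expR v)^-1 <= v^-1.
Proof.
move=> v0; rewrite lef_pV2 ?posrE ?expR_gt0 //.
by apply: le_trans (expR_ge1Dx v); lra.
Qed.

Lemma sqr_half_le_expR (R : realType) (v : R) : 0 <= v -> v ^+ 2 / 2 <= expR v.
Proof. by move=> v0; have := expR_ge1Dxn 1 v0; rewrite -[(2`!)%:R]/(2 : R); lra. Qed.

Lemma ln_leB1 (R : realType) (v : R) : 0 < v -> ln v <= v - 1.
Proof.
by move=> v0; have := @le_ln1Dx R (v - 1); rewrite addrCA subrr addr0; apply; lra.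
Qed.

Lemma lnln_gt0 (R : realType) (v : R) : 0 < ln (ln v) ->
  [/\ 1 < v, 1 < ln v & expR (ln (ln v)) = ln v].
Proof.
move=> h.
have gt1 (u : R) : 0 < ln u -> 1 < u.
  by move=> u0; rewrite ltNge; apply/negP => /ln_le0; lra.
have l1 := gt1 _ h; have v1 : 1 < v by apply: gt1; lra.
by split => //; rewrite lnK // posrE; lra.
Qed.

(** Here exp l stands for log n: the number of blocks is of order log n and cancels one factor, and
    (log n)^(- delta / 2) remains. *)
Lemma union_tail (R : realType) (delta e L l K : R) :
  0 < delta -> 0 < e -> 0 < L -> 1 <= l -> K <= expR l * (L^-1 + 2) ->
  16 * (L^-1 + 2) / (delta * e) <= l -> K * (2 / expR (l + delta / 2 * l)) <= e / 4.
Proof.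
move=> dl0 e0 L0 l1 K1 l3; rewrite expRD.
have l0 : 0 < l := lt_le_trans ltr01 l1.
have v0 : 0 < delta / 2 * l by rewrite mulr_gt0 ?divr_gt0.
have Li : 0 < L^-1 by rewrite invr_gt0.
apply: (@le_trans _ _ (expR l * (L^-1 + 2) * (2 / (expR l * expR (delta / 2 * l))))).
  by apply: ler_wpM2r => //; rewrite divr_ge0 // mulr_ge0 ?expR_ge0.
have -> : expR l * (L^-1 + 2) * (2 / (expR l * expR (delta / 2 * l))) =
   (L^-1 + 2) * 2 * (expR (delta / 2 * l))^-1.
  by field; rewrite !gt_eqF ?expR_gt0.
apply: (@le_trans _ _ ((L^-1 + 2) * 2 * (delta / 2 * l)^-1)).
  by apply: ler_wpM2l; [rewrite mulr_ge0 // addr_ge0 // ltW|exact: inv_expR_le].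
move: l3; rewrite !ler_pdivrMr ?mulr_gt0 //; move: L^-1 => v; clear; lra.
Qed.

Lemma hc_type1_small (R : realType) (delta e : R) : 0 < delta -> 0 < e ->
  exists M : R, forall (d : measure_display) (T : measurableType d)
    (mu : probability T R) (n : nat) (Y : nat -> T -> R) (c : R),
  null_model mu n Y -> M <= ln (ln n%:R) ->
  prob mu [set w | ((hc_threshold delta n)%:E <= HCplus n c (Y^~ w))%E] <= e.
Proof.
move=> dl0 e0.
(* Then 19 a (1 + delta) = delta / 2, and x^2 / 2 (1 - 19 a) = (1 + delta / 2) log log n: half of
   delta pays for the width of the blocks. *)
pose a := delta / (38 * (1 + delta)).
have d1 : 0 < 1 + delta by lra.
have a0 : 0 < a by rewrite divr_gt0 // mulr_gt0.
have aE : a * 38 * (1 + delta) = delta by rewrite /a; field; rewrite gt_eqF.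
have a38 : a <= 38^-1 by nra.
have L0 : 0 < ln (1 + a) by rewrite ln_gt0 //; lra.
have [L LE] : exists L, L = ln (1 + a) by eexists.
rewrite -LE in L0; clearbody a.
have ae0 : 0 < a * e by rewrite mulr_gt0.
have de0 : 0 < delta * e by rewrite mulr_gt0.
(* [M1], [M2] and [M3] bring the four error terms below e / 4 each, [M2] serving both ends; [M4]
   ensures x^2 / a^2 <= n. *)
have [M1 M1E] : exists M1, M1 = 4 / e by eexists.
have [M2 M2E] : exists M2, M2 = 64 / (a * e) by eexists.
have [M3 M3E] : exists M3, M3 = 16 * (L^-1 + 2) / (delta * e) by eexists.
have [M4 M4E] : exists M4, M4 = 4 * (1 + delta) / a ^+ 2 by eexists.
have M10 : 0 < M1 by rewrite M1E divr_gt0.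
have M20 : 0 < M2 by rewrite M2E divr_gt0.
have M30 : 0 < M3 by rewrite M3E divr_gt0 ?mulr_gt0 // addr_gt0 // invr_gt0.
have M40 : 0 < M4 by rewrite M4E; apply: divr_gt0; [exact: mulr_gt0|exact: exprn_gt0].
exists (1 + M1 ^+ 2 + (M2 ^+ 2) ^+ 2 + M3 + M2 + M4).
move=> d T mu n Y c H0 hl; set l := ln (ln n%:R) in hl.
have [l1 lM1 lM2 [l3 l4 l5]] : [/\ 1 <= l, M1 ^+ 2 <= l, (M2 ^+ 2) ^+ 2 <= l &
    [/\ M3 <= l, M2 <= l & M4 <= l]].
  have := sqr_ge0 M1; have := sqr_ge0 (M2 ^+ 2).
  by move: (M1 ^+ 2) ((M2 ^+ 2) ^+ 2) l hl => u v l hl v0 u0; do 2?split; lra.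
have [n1 ln1 lE] := @lnln_gt0 R n%:R (lt_le_trans ltr01 l1).
rewrite -/l in lE; clear hl.
have n0 : (0 < n)%N by rewrite -(ltr_nat R); lra.
pose x := hc_threshold delta n.
have x2 : x ^+ 2 = 2 * (1 + delta) * l
  by rewrite /x /hc_threshold -/l sqr_sqrtr // mulr_ge0 //; lra.
have xge0 : 0 <= x by exact: sqrtr_ge0.
have x2l : l <= x ^+ 2 by rewrite x2; nra.
have xge v : 0 <= v -> v ^+ 2 <= l -> v <= x.
  move=> v0 vl; rewrite -(ler_pXn2r (ltn0Sn 1)) ?nnegrE //.
  exact: le_trans x2l.
have x1 : 1 <= x by apply: xge => //; rewrite expr1n.
have x0 : 0 < x by lra.
pose K := (Num.truncn (ln n%:R / L)).+1.
have LL : 0 <= ln n%:R / L by rewrite divr_ge0 ?(ltW L0) // (le_trans ler01) // ltW.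
have /andP[Kl Ku] : (Num.truncn (ln n%:R / L))%:R <= ln n%:R / L < K%:R.
  exact: truncn_itv.
have nK : n%:R <= (1 + a) ^+ K.
  rewrite -[n%:R](@lnK R) ?posrE ?ltr0n // -[leRHS](@lnK R); last first.
    by rewrite posrE exprn_gt0 //; lra.
  rewrite ler_expR lnXn; last by lra.
  by rewrite -[_ *+ K]mulr_natl -LE -ler_pdivrMr // ltW.
have nl : l ^+ 2 / 2 <= n%:R.
  have h : l ^+ 2 / 2 <= expR l := sqr_half_le_expR (le_trans ler01 l1).
  have h' : ln n%:R <= n%:R - 1 :> R := ln_leB1 (lt_trans ltr01 n1).
  rewrite lE in h; apply: (le_trans h); apply: (le_trans h').
  by rewrite gerBl ler01.
have xan : x ^+ 2 / a ^+ 2 <= n%:R.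
  apply: le_trans nl; rewrite x2.
  have -> : 2 * (1 + delta) * l / a ^+ 2 = (4 * (1 + delta) / a ^+ 2) * l / 2.
    by field; rewrite gt_eqF.
  have l0 : 0 <= l := le_trans ler01 l1.
  by rewrite -M4E ler_pM2r // expr2 ler_wpM2r.
have a01 : 0 < a <= 38^-1 by rewrite a0 a38.
apply: le_trans (hc_type1 c H0 n0 x1 a01 xan nK) _; rewrite -/x.
have b1 : x^-1 <= e / 4.
  rewrite invf_ple ?posrE ?divr_gt0 // invf_div -M1E.
  by apply: xge => //; exact: ltW.
have b2 : 2 / expR (a * Num.sqrt x / 8) <= e / 4.
  have sx : M2 <= Num.sqrt x.
    rewrite -[leLHS]gtr0_norm // -sqrtr_sqr ler_wsqrtr //.
    by apply: xge => //; exact: sqr_ge0.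
  have s0 : 0 < Num.sqrt x by rewrite sqrtr_gt0.
  have v0 : 0 < a * Num.sqrt x / 8 by rewrite divr_gt0 // mulr_gt0.
  apply: (@le_trans _ _ (2 * (a * Num.sqrt x / 8)^-1)).
    by apply: ler_wpM2l => //; exact: inv_expR_le.
  move: sx; rewrite M2E !ler_pdivrMr //; move: (Num.sqrt x) => r; clear; lra.
have b4 : 2 / expR (a * x ^+ 2 / 8) <= e / 4.
  have v0 : 0 < a * x ^+ 2 / 8 by rewrite divr_gt0 // mulr_gt0 // exprn_gt0.
  apply: (@le_trans _ _ (2 * (a * x ^+ 2 / 8)^-1)).
    by apply: ler_wpM2l => //; exact: inv_expR_le.
  have : M2 <= x ^+ 2 := le_trans l4 x2l.
  by rewrite M2E !ler_pdivrMr //; move: (x ^+ 2) => r; clear; lra.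
have b3 : K.+1%:R * (2 / expR (x ^+ 2 / 2 * (1 - 19 * a))) <= e / 4.
  have -> : x ^+ 2 / 2 * (1 - 19 * a) = l + delta / 2 * l.
    have -> : x ^+ 2 / 2 * (1 - 19 * a) = l * (1 + delta - a * 38 * (1 + delta) / 2).
      by rewrite x2; field.
    by rewrite aE; field.
  apply: (union_tail dl0 e0 L0 l1); last by rewrite -M3E.
  rewrite lE /K -natr1 -natr1; have h : 1 <= ln n%:R :> R := ltW ln1.
  move: Kl h; rewrite mulrDr; clear; lra.
apply: (le_trans (lerD (lerD (lerD b1 b2) b3) b4)); clear; lra.
Qed.

(** The squared ratio of the excess n eps D to the noise sqrt (n D) is n eps^2 D, at least n^(1 - q
    - 2 p) / C. The minorant exp v >= v^2 / 2 turns this into G (log n)^2, which beats every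
    multiple of log log n. *)
Lemma hc_type2_small (R : realType) (W : finType) (p q delta e Ce Cd : R) :
  q + 2 * p < 1 -> 0 < delta -> 0 < e -> 0 < Ce -> 0 < Cd ->
  exists M : R, forall (d : measure_display) (T : measurableType d)
    (mu : probability T R) (n : nat) (eps D c : R)
    (Pt : nat -> T -> W -> R) (U : nat -> T -> W -> R) (wt : nat -> T -> W),
  assumptionA mu n eps Pt U wt -> as_PDelta mu n D Pt ->
  n%:R `^ (- p) <= Ce * eps -> n%:R `^ (- q) <= Cd * D -> c <= D ->
  M <= ln (ln n%:R) ->
  prob mu [set x | (HCplus n c (fun t => U t x (wt t x)) < (hc_threshold delta n)%:E)%E] <= e.
Proof.
move=> pq dl0 e0 Ce0 Cd0.
pose k := kappa R W; have k0 : 0 < k := kappa_gt0 R W.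
pose g := 1 - q - 2 * p; have g0 : 0 < g by rewrite /g; lra.
pose C := Ce ^+ 2 * Cd; have C0 : 0 < C by rewrite mulr_gt0 // exprn_gt0.
have k20 : 0 < k ^+ 2 by rewrite exprn_gt0.
have ke0 : 0 < k ^+ 2 * e by rewrite mulr_gt0.
have [G GE] : exists G, G = g ^+ 2 / (2 * C) by eexists.
have G0 : 0 < G by rewrite GE divr_gt0 ?exprn_gt0 ?mulr_gt0.
have [M1 M1E] : exists M1, M1 = 12 / k / G by eexists.
have [M2 M2E] : exists M2, M2 = 8 * (1 + delta) / k ^+ 2 / G by eexists.
have [M3 M3E] : exists M3, M3 = 128 / (k ^+ 2 * e) / G by eexists.
have d1 : 0 < 1 + delta by lra.
have M10 : 0 < M1 by rewrite M1E !divr_gt0.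
have M20 : 0 < M2 by rewrite M2E !divr_gt0 ?(mulr_gt0 _ d1).
have M30 : 0 < M3 by rewrite M3E !divr_gt0.
exists (1 + M1 + M2 + M3).
move=> d T mu n eps D c Pt U wt HA HD heps hD cD hl.
set l := ln (ln n%:R) in hl.
have [l1 lM1 lM2 lM3] : [/\ 1 <= l, M1 <= l, M2 <= l & M3 <= l].
  by clear -hl M10 M20 M30; split; lra.
have [n1 ln1 lE] := @lnln_gt0 R n%:R (lt_le_trans ltr01 l1).
pose La := ln (n%:R : R).
have lLa : l <= La by rewrite /l; have /le_trans : ln La <= La - 1 := ln_leB1 (lt_trans ltr01 ln1); apply; clear; lra.
have n0R : 0 < n%:R :> R := lt_trans ltr01 n1.
have nE : expR La = n%:R by rewrite lnK // posrE.
have pw v : n%:R `^ v = expR (v * La) :> R by rewrite /powR gt_eqF.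
rewrite !pw in heps hD.
have eps0 : 0 < eps by rewrite -(pmulr_rgt0 _ Ce0); apply: lt_le_trans heps; exact: expR_gt0.
have D0 : 0 < D by rewrite -(pmulr_rgt0 _ Cd0); apply: lt_le_trans hD; exact: expR_gt0.
have XC : G * La ^+ 2 <= n%:R * eps ^+ 2 * D.
  have h1 : expR (- p * La) ^+ 2 <= (Ce * eps) ^+ 2.
    by rewrite lerXn2r ?nnegrE ?expR_ge0 // (mulr_ge0 (ltW Ce0) (ltW eps0)).
  have h2 : expR (g * La) <= C * (n%:R * eps ^+ 2 * D).
    have -> : expR (g * La) = n%:R * (expR (- p * La) ^+ 2 * expR (- q * La)).
      by rewrite -nE -expRM_natl -!expRD /g; congr expR; ring.
    have -> : C * (n%:R * eps ^+ 2 * D) = n%:R * ((Ce * eps) ^+ 2 * (Cd * D)).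
      by rewrite /C; ring.
    by rewrite ler_wpM2l // ler_pM ?expR_ge0 ?sqr_ge0.
  have h3 : (g * La) ^+ 2 / 2 <= expR (g * La).
    by apply: sqr_half_le_expR; rewrite mulr_ge0 ?(ltW g0) // (ltW (lt_trans ltr01 ln1)).
  have -> : G * La ^+ 2 = (g * La) ^+ 2 / 2 / C by rewrite GE; field; rewrite gt_eqF.
  by rewrite ler_pdivrMr // [leRHS]mulrC (le_trans h3).
have La1 : 1 <= La := ltW ln1.
have La0 : 0 < La := lt_trans ltr01 ln1.
set X := n%:R * eps ^+ 2 * D in XC.
have XG : G * La * La <= X by rewrite -mulrA -expr2.
have GLa : 0 < G * La by rewrite mulr_gt0.
have XL : G * La <= X by apply: le_trans XG; rewrite ler_peMr // ltW.
have big v : v / G <= La -> v <= X.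
  by rewrite ler_pdivrMr // mulrC => /le_trans; apply.
have x2 : hc_threshold delta n ^+ 2 = 2 * (1 + delta) * l.
  by rewrite /hc_threshold -/l sqr_sqrtr // mulr_ge0 ?mulr_ge0 ?(ltW d1) // (le_trans ler01 l1).
have thr0 : 0 < hc_threshold delta n.
  by rewrite /hc_threshold -/l sqrtr_gt0 !mulr_gt0 // (lt_le_trans ltr01 l1).
have l0 : 0 < l := lt_le_trans ltr01 l1.
have n2 : (1 < n)%N by rewrite -(ltr_nat R).
have X0 : 0 < X := lt_le_trans GLa XL.
apply: le_trans (hc_type2 HA HD n2 D0 eps0 thr0 cD _ _) _.
- by apply: big; rewrite -/k -M1E (le_trans lM1).
- rewrite x2 -/X -/k.
  have : 8 * (1 + delta) / k ^+ 2 * La <= X.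
    apply: le_trans XG; apply: ler_wpM2r; first exact: ltW.
    by rewrite [leRHS]mulrC -ler_pdivrMr // -M2E (le_trans lM2).
  have -> : 8 * (1 + delta) / k ^+ 2 * La = 8 * (1 + delta) * La / k ^+ 2 by ring.
  rewrite ler_pdivrMr // mulrC => h.
  have : (1 + delta) * l <= (1 + delta) * La by rewrite ler_wpM2l // ltW.
  by move: h; clear; lra.
- rewrite -/X -/k expRN.
  have v0 : 0 < k ^+ 2 * X / 128 by rewrite divr_gt0 // mulr_gt0.
  apply: le_trans (inv_expR_le v0) _.
  have : 128 / (k ^+ 2 * e) <= X by apply: big; rewrite -M3E (le_trans lM3).
  rewrite ler_pdivrMr // => h.
  by rewrite invf_ple ?posrE // -[leLHS]mul1r ler_pdivrMr //; move: h; clear; lra.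
Qed.

Lemma near_lnln_ge (R : realType) (M : R) : \forall n \near \oo, M <= ln (ln n%:R).
Proof.
near=> n.
have h : expR (expR M) <= n%:R by near: n; exact: nbhs_infty_ger.
have n0 : 0 < n%:R :> R by apply: lt_le_trans h; exact: expR_gt0.
have h1 : expR M <= ln n%:R by rewrite -[leLHS]expRK ler_ln ?posrE ?expR_gt0.
by rewrite -[leLHS]expRK ler_ln ?posrE ?expR_gt0 //; apply: lt_le_trans h1; exact: expR_gt0.
Unshelve. all: by end_near.
Qed.

Theorem theoremA1 (R : realType) (W : finType) (p q delta : R) (eps Delta c : nat -> R)
  (d : nat -> measure_display) (Omega : forall n, measurableType (d n))
  (mu : forall n, probability (Omega n) R)
  (Pt : forall n, nat -> Omega n -> W -> R) (U : forall n, nat -> Omega n -> W -> R)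
  (wt : forall n, nat -> Omega n -> W)
  (d0 : nat -> measure_display) (Omega0 : forall n, measurableType (d0 n))
  (mu0 : forall n, probability (Omega0 n) R) (Y0 : forall n, nat -> Omega0 n -> R) :
  0 <= p -> 0 <= q -> q + 2 * p < 1 ->
  asymp eps (fun n => n%:R `^ (- p)) ->
  asymp Delta (fun n => n%:R `^ (- q)) ->
  (forall n, assumptionA (mu n) n (eps n) (Pt n) (U n) (wt n)) ->
  (forall n, as_PDelta (mu n) n (Delta n) (Pt n)) ->
  0 < delta ->
  (forall n, 0 <= c n <= Delta n) ->
  (forall n, null_model (mu0 n) n (Y0 n)) ->
  (fun n => fine
     (mu0 n [set x | (hc_threshold delta n)%:E <= HCplus n (c n) (fun t => Y0 n t x)]
      + mu n [set x | HCplus n (c n) (fun t => U n t x (wt n t x)) < (hc_threshold delta n)%:E])%E)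
    @ \oo --> (0 : R).

Proof.
move=> p0 q0 pq [? [Ce [_ [Ce0 heps]]]] [? [Cd [_ [Cd0 hD]]]] HA HD dl0 hc H0.
apply/cvgrPdist_le => e e0.
have e20 : 0 < e / 2 by lra.
have [M1 HM1] := hc_type1_small dl0 e20.
have [M2 HM2] := @hc_type2_small R W p q delta (e / 2) Ce Cd pq dl0 e20 Ce0 Cd0.
near=> n.
(* The maximum with 1 keeps log log n positive, so that n >= 2 and the threshold is positive. *)
have m1 : Num.max M1 1 <= ln (ln n%:R) by near: n; exact: near_lnln_ge.
have m2 : M2 <= ln (ln n%:R) by near: n; exact: near_lnln_ge.
move: m1; rewrite ge_max => /andP[m1 l1].
have [n1 _ _] := @lnln_gt0 R n%:R (lt_le_trans ltr01 l1).
have n0 : (0 < n)%N by rewrite -(ltr_nat R) (lt_trans ltr01).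
have thr0 : 0 < hc_threshold delta n by rewrite /hc_threshold sqrtr_gt0 mulr_gt0 ?(lt_le_trans ltr01 l1) //; lra.
have mE0 : measurable [set x | ((hc_threshold delta n)%:E <= HCplus n (c n) (fun t => Y0 n t x))%E].
  by apply: (@measurable_HCplus_ge R _ _ n (c n) _ (Y0 n)) => //; case: (H0 n).
have mE1 : measurable [set x | (HCplus n (c n) (fun t => U n t x (wt n t x)) < (hc_threshold delta n)%:E)%E].
  rewrite (_ : [set _ | _] =
    ~` [set x | ((hc_threshold delta n)%:E <= HCplus n (c n) (fun t => U n t x (wt n t x)))%E]).
    apply: measurableC.
    apply: (@measurable_HCplus_ge R _ _ n (c n) _ (fun t x => U n t x (wt n t x))) => //.
    by move=> t; exact: (watermark_measurable (HA n)).
  by apply/seteqP; split => x /=; [move=> h; apply/negP|move=> /negP]; rewrite -ltNge.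
have h1 := HM1 _ _ (mu0 n) n (Y0 n) (c n) (H0 n) m1.
have h2 := HM2 _ _ (mu n) n (eps n) (Delta n) (c n) (Pt n) (U n) (wt n) (HA n) (HD n)
  (heps n n0).2 (hD n n0).2 (andP (hc n)).2 m2.
rewrite (probE (mu0 n) mE0) (probE (mu n) mE1) -EFinD /= sub0r normrN.
rewrite ger0_norm; last by rewrite addr_ge0 // prob_ge0.
by apply: (le_trans (lerD h1 h2)); clear; lra.
Unshelve. all: by end_near.
Qed.
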